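(* For every message assignment satisfying the cooperation order constraint $M=2$ (i.e. $|\mathcal T_i|\le 2$ for all $i$) and every realization of a general $K$-user dynamic linear network, Algorithm 1 (defined in the context), applied to each atomic subnetwork in a partition of the network into atomic subnetworks, achieves the optimal zero-forcing DoF of the network, i.e. the largest number of active users over all cooperative zero-forcing schemes for that message assignment and realization.
   Context: Network. $K$ single-antenna transmitters and receivers, $Y_i=\sum_j H_{i,j}X_j+Z_i$ with unit-variance Gaussian noise; $H_{i,j}=0$ unless $i\in\{j,j+1\}$. A realization specifies which of the links $(i,j)$, $i\in\{j,j+1\}$, are erased ($H_{i,j}=0$); the remaining coefficients are generic (drawn independently from a continuous distribution) and known everywhere. ''Connected'' means joined by a non-erased link. Receiver $i$ wants $W_i$; $\mathcal T_i$ is the set of transmitters knowing $W_i$. Zero-forcing schemes. Each message is either not transmitted or allocated one degree of freedom, and an active receiver observes no interference. Concretely, for an active set $\mathcal S$ there are beam coefficients $v_{i,j}$ ($i\in\mathcal S$, $j\in\mathcal T_i$), $X_j=\sum_{i\in\mathcal S:\,j\in\mathcal T_i}v_{i,j}s_i$ with $s_i$ encoding $W_i$, such that for $i\in\mathcal S$: $\sum_{j\in\mathcal T_i}H_{i,j}v_{i,j}\ne0$ and $\sum_{j\in\mathcal T_i}H_{k,j}v_{i,j}=0$ for all $k\in\mathcal S\setminus\{i\}$. The DoF is $|\mathcal S|$. Subnetworks. $W_i$ is enabled if some transmitter in $\mathcal T_i$ is connected to receiver $i$. $G_i$ is the graph on $\mathcal T_i$ in which $x,y$ are adjacent if transmitters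 $x,y$ are connected to a common receiver; vertex $i$ (resp. $i-1$) is marked if $H_{i,i}\ne0$ (resp. $H_{i,i-1}\neq0$). The assignment of $W_i$ to transmitter $x$ is useful if $x$ is connected in $G_i$ to a marked vertex. A message assignment is irreducible if every $G_i$ has only one component. The topology-reduced message assignment is obtained by first removing all receivers whose messages are not enabled and then removing from every transmit set all elements that are not useful. Users $\{i,\dots,i+k-1\}$ form a subnetwork if (1) $i=1$, or, for the topology-reduced assignment, either $W_i$ is not enabled, or there is no message $W_x$, $x<i$, available at a transmitter connected to receiver $i$ and $W_i$ is not available at a transmitter connected to any receiver with index $x<i$; and (2) $i+k-1=K$ or condition (1) holds for $i+k$ in place of $i$. A subnetwork is atomic if it contains no smaller subnetwork. In an atomic subnetwork, the transmitters carrying messages of its users have successive indices, and $H_{r,t}\neq0$ for every such transmitter $t$ and every receiver $r\in\{t,t+1\}$ in the subnetwork. Users whose message is not enabled are never active. Algorithm 1. Input: an atomic subnetwork whose messages are enabled, users relabelled $1,\dots,N$ (the transmitter preceding transmitter $1$ is labelled $0$), with topology-reduced transmit sets $\mathcal T_1,\dots,\mathcal T_N$. Binary variables $b_{i,j}$ ($1\le i\le N$, $j\in\{i-2,i-1,i,i+1\}$) are initialized to $0$. (1) If $H_{1,0}\neq0$ and $0\in\mathcal T_1$, set $b_{1,0}=1$; otherwise set $b_{1,1}=1$. (2) If $N\ge2$: (2a) If $1\in\mathcal T_2$ and $b_{1,1}=0$: if moreover $0\in\mathcal T_2$ and $H_{1,0}\ne0$, set $b_{2,1}=b_{2,0}=1$.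 Else (i.e. if not both $1\in\mathcal T_2$ and $b_{1,1}=0$), if $0\in\mathcal T_2$, $H_{1,0}\neq0$ and $2\in\mathcal T_1$, set $b_{2,1}=b_{2,0}=b_{1,2}=b_{1,1}=1$. (2b) If then $b_{2,1}=0$ and $2\in\mathcal T_2$: if $b_{1,1}=0$ set $b_{2,2}=1$; else if $2\in\mathcal T_1$ set $b_{2,2}=b_{1,2}=1$. (3) For $i=3,\dots,N$ in order: (3a) If $(i-1)\in\mathcal T_i$ and $b_{i-1,i-1}=0$: if $b_{i-1,i-2}=0$ set $b_{i,i-1}=1$; else if $(i-2)\in\mathcal T_i$, $b_{i-2,i-2}=0$ and $b_{i-2,i-3}=0$, set $b_{i,i-1}=b_{i,i-2}=1$. Else (i.e. if not both $(i-1)\in\mathcal T_i$ and $b_{i-1,i-1}=0$), if $(i-2)\in\mathcal T_i$, $i\in\mathcal T_{i-1}$, $b_{i-2,i-3}=0$ and $b_{i-2,i-2}=0$, set $b_{i,i-1}=b_{i,i-2}=b_{i-1,i}=b_{i-1,i-1}=1$. (3b) If $i\in\mathcal T_i$, $b_{i,i-1}=0$ and $b_{i-2,i-1}=0$: if $b_{i-1,i-1}=0$ set $b_{i,i}=1$; else if $i\in\mathcal T_{i-1}$ set $b_{i,i}=b_{i-1,i}=1$. (4) For $i\in[N]$, $j\in\{i-1,i\}$, let $X_{i,j}$ be generated from $W_i$ by an optimal AWGN point-to-point code. Output, for $0\le j\le N$, $$X_j=b_{j,j}X_{j,j}+b_{j+1,j}X_{j+1,j}-b_{j-1,j}\frac{H_{j,j-1}}{H_{j,j}}X_{j-1,j-1}-b_{j+2,j}\frac{H_{j+1,j+1}}{H_{j+1,j}}X_{j+2,j+1},$$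 where terms whose message index is not in $[N]$ are omitted, and $X_N$ is used only if $H_{N,N}\neq0$.
   Formalization: The condition for a subnetwork to begin at user i is strengthened: no W_y with y ≥ i (not only W_i) may be available at a transmitter connected to a receiver with index below i. With W_i alone the claim fails: K=4, no erasures, T_1=∅, T_2={1}, T_3={3,4}, T_4={2,3}. *)

(* Defs.v *)
(* MathComp world (MathComp-Analysis for the random channel coefficients). *)
From HB Require Import structures.
From mathcomp Require Import all_boot all_order all_algebra.
From mathcomp Require Import finmap.
From mathcomp Require Import all_classical all_reals all_analysis.

Set Implicit Arguments.
Unset Strict Implicit.
Unset Printing Implicit Defensive.

Import Order.TTheory GRing.Theory Num.Theory.
Local Open Scope ring_scope.

(* Users, receivers and transmitters carry the labels 1, ..., K, as naturals;
   inside a subnetwork, transmitter 0 is the one preceding transmitter 1.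
   A message assignment is a function T : nat -> {fset nat}, of which only the
   values at 1, ..., K matter.  A connectivity relation conn : rel nat reads
   "receiver i is connected to transmitter j" for conn i j. *)

Definition users (K : nat) : {fset nat} := [fset i in iota 1 K]%fset.

(** * Network realizations *)

Definition link (K : nat) (erased : rel nat) : rel nat := fun i j =>
  [&& i \in users K, j \in users K, (i == j) || (i == j.+1) & ~~ erased i j].

Section Realization.
Context {d : measure_display} {Om : measurableType d} {R : realType}.
Variable P : probability Om R.

Definition channel (K : nat) (erased : rel nat)
    (g : nat -> nat -> {RV P >-> R}) (w : Om) : nat -> nat -> R :=
  fun i j => if link K erased i j then g i j w else 0.

Definition continuous_distribution (X : {RV P >-> R}) : Prop :=
  forall r : R, distribution P X [set r]%classic = 0%E.

(* Mutual independence of the coefficients g i j of the links in L: the product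
   rule for every finite subfamily. *)
Definition independent_coefficients (L : rel nat)
    (g : nat -> nat -> {RV P >-> R}) : Prop :=
  forall (J : {fset nat * nat}) (B : nat * nat -> set R),
    (forall l, l \in J -> L l.1 l.2) ->
    (forall l, l \in J -> measurable (B l)) ->
    P [set w | forall l, l \in J -> B l (g l.1 l.2 w)]%classic =
    (\prod_(l <- J) P (g l.1 l.2 @^-1` B l)%classic)%E.

(* Each remaining coefficient may have its own continuous distribution. *)
Definition generic_coefficients (K : nat) (erased : rel nat)
    (g : nat -> nat -> {RV P >-> R}) : Prop :=
  independent_coefficients (link K erased) g /\
  (forall i j, link K erased i j -> continuous_distribution (g i j)).

End Realization.

(** * Zero-forcing schemes *)

Section ZeroForcing.
Variables (R : fieldType) (K : nat) (T : nat -> {fset nat}).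
Variable H : nat -> nat -> R.

(* v i j is the coefficient of the codeword of W_i in the signal of
   transmitter j; it is extended by 0 where the scheme has no coefficient. *)
Definition zf_scheme (S : {fset nat}) (v : nat -> nat -> R) : Prop :=
  [/\ (S `<=` users K)%fset,
      forall i j, ~~ ((i \in S) && (j \in T i)) -> v i j = 0,
      forall i, i \in S -> \sum_(j <- T i) H i j * v i j != 0 &
      forall i k, i \in S -> k \in S -> k != i ->
        \sum_(j <- T i) H k j * v i j = 0].

Definition zf_optimal (S : {fset nat}) (v : nat -> nat -> R) : Prop :=
  zf_scheme S v /\
  forall S' v', zf_scheme S' v' -> (#|` S'| <= #|` S|)%N.

End ZeroForcing.

(** * Topology reduction *)

Section Topology.
Variables (K : nat) (conn : rel nat) (T : nat -> {fset nat}).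

(* W_x is available at a transmitter connected to receiver r. *)
Definition reaches (x r : nat) : bool := has (conn r) (T x).

Definition enabled (i : nat) : bool := reaches i i.

Definition common_receiver (x y : nat) : bool :=
  has (fun r => conn r x && conn r y) (iota 1 K).

Definition assignment_graph (i : nat) : rel (T i) :=
  fun x y => common_receiver (val x) (val y).

Definition marked (i y : nat) : bool :=
  ((y == i) || (y.+1 == i)) && conn i y.

Definition useful (i x : nat) : bool :=
  [exists x' : T i, exists y : T i,
     [&& val x' == x, marked i (val y) & connect (@assignment_graph i) x' y]].

End Topology.

(* The receivers of messages that are not enabled are gone, hence so are
   their links. *)
Definition reduced_conn (conn : rel nat) (T : nat -> {fset nat}) : rel nat :=
  fun i j => enabled conn T i && conn i j.

Definition reduced_assignment (K : nat) (conn : rel nat)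
    (T : nat -> {fset nat}) : nat -> {fset nat} :=
  fun i => [fset x in T i | useful K (reduced_conn conn T) T i x]%fset.

(** * Subnetworks *)

Section Subnetworks.
Variables (K : nat) (conn : rel nat) (T : nat -> {fset nat}).

(* The last clause concerns all the messages W_y with y >= i, and not W_i
   alone.  With y = i only, W_(i+1) may sit at transmitter i-1 while the latter
   is still heard by receiver i-1: the two sides of the boundary i interact and
   cannot be scheduled separately.  For K = 4 without erasures and
   T_1 = {}, T_2 = {1}, T_3 = {3,4}, T_4 = {2,3}, users {2} and {3,4} would be
   separate subnetworks, where the algorithm activates 1 and 2 users, whereas
   at most 2 of the users 2, 3, 4 can be active together. *)
Definition boundary (i : nat) : bool :=
  let conn' := reduced_conn conn T in
  let T' := reduced_assignment K conn T in
  [|| i == 1%N, ~~ enabled conn T i |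
    ~~ has (fun x => reaches conn' T' x i) (iota 1 i.-1) &&
    ~~ has (fun y => has (fun x => reaches conn' T' y x) (iota 1 i.-1))
           (iota i (K.+1 - i))].

Definition subnetwork (i k : nat) : bool :=
  [&& (0 < i)%N, (0 < k)%N, (i + k <= K.+1)%N, boundary i &
    (i + k == K.+1) || boundary (i + k)].

Definition atomic (i k : nat) : Prop :=
  subnetwork i k /\
  forall i' k', subnetwork i' k' -> (i <= i')%N -> (i' + k' <= i + k)%N ->
    i' = i /\ k' = k.

(* A list of pairs (first user, number of users), from left to right. *)
Definition atomic_partition (p : seq (nat * nat)) : Prop :=
  (forall q, q \in p -> atomic q.1 q.2) /\
  flatten [seq iota q.1 q.2 | q <- p] = iota 1 K.

End Subnetworks.

(** * The algorithm on one subnetwork *)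

Section Algorithm.
Variables (R : fieldType) (N : nat).
(* Local labels; has_msg i j means that j belongs to the transmit set T_i. *)
Variables (has_msg : rel nat) (H : nat -> nat -> R).

(* The pairs (i, j) such that b_(i,j) = 1. *)
Definition bits := seq (nat * nat).

Definition b (s : bits) (i j : nat) : bool := (i, j) \in s.

Definition step1 : bits :=
  if (H 1 0 != 0) && has_msg 1 0 then [:: (1, 0)%N] else [:: (1, 1)%N].

Definition step2a (s : bits) : bits :=
  if has_msg 2 1 && ~~ b s 1 1 then
    if has_msg 2 0 && (H 1 0 != 0) then [:: (2, 1), (2, 0) & s]%N else s
  else if [&& has_msg 2 0, H 1 0 != 0 & has_msg 1 2] then
    [:: (2, 1), (2, 0), (1, 2), (1, 1) & s]%N
  else s.

Definition step2b (s : bits) : bits :=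
  if ~~ b s 2 1 && has_msg 2 2 then
    if ~~ b s 1 1 then (2, 2)%N :: s
    else if has_msg 1 2 then [:: (2, 2), (1, 2) & s]%N else s
  else s.

(* The steps 3a and 3b are only used with i >= 3. *)
Definition step3a (s : bits) (i : nat) : bits :=
  (if has_msg i (i - 1) && ~~ b s (i - 1) (i - 1) then
    if ~~ b s (i - 1) (i - 2) then (i, i - 1) :: s
    else if [&& has_msg i (i - 2), ~~ b s (i - 2) (i - 2)
              & ~~ b s (i - 2) (i - 3)] then
      [:: (i, i - 1), (i, i - 2) & s]
    else s
  else if [&& has_msg i (i - 2), has_msg (i - 1) i, ~~ b s (i - 2) (i - 3)
            & ~~ b s (i - 2) (i - 2)] then
    [:: (i, i - 1), (i, i - 2), (i - 1, i), (i - 1, i - 1) & s]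
  else s)%N.

Definition step3b (s : bits) (i : nat) : bits :=
  (if [&& has_msg i i, ~~ b s i (i - 1) & ~~ b s (i - 2) (i - 1)] then
    if ~~ b s (i - 1) (i - 1) then (i, i) :: s
    else if has_msg (i - 1) i then [:: (i, i), (i - 1, i) & s] else s
  else s)%N.

Definition algorithm_bits : bits :=
  let s1 := step1 in
  let s2 := if (2 <= N)%N then step2b (step2a s1) else s1 in
  foldl (fun s i => step3b (step3a s i) i) s2 (iota 3 (N - 2)).

(* The coefficient of the codeword of W_i in the output X_j.  X_(i,i-1) and
   X_(i,i) both encode W_i and are the same codeword.  For j = 0 the terms with
   j.-1 vanish, as i.+1 == 0 is false. *)
Definition algorithm_coef (i j : nat) : R :=
  let s := algorithm_bits in
  if [&& (0 < i <= N)%N, (j <= N)%N & (j != N) || (H N N != 0)] then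
    (b s j j && (i == j))%:R
    + (b s j.+1 j && (i == j.+1))%:R
    - (b s j.-1 j && (i.+1 == j))%:R * (H j j.-1 / H j j)
    - (b s j.+2 j && (i == j.+2))%:R * (H j.+1 j.+1 / H j.+1 j)
  else 0.

End Algorithm.

(** * The algorithm on a partitioned network *)

Section NetworkAlgorithm.
Variables (R : fieldType) (K : nat) (conn : rel nat) (T : nat -> {fset nat}).
Variable H : nat -> nat -> R.

(* In the subnetwork {m, ..., m + k - 1}, the user or transmitter m.-1 + r has
   the local label r.  Subnetworks with a message that is not enabled are
   silent. *)
Definition subnetwork_coef (q : nat * nat) (i j : nat) : R :=
  let o := q.1.-1 in
  if [&& all (enabled conn T) (iota q.1 q.2), (o < i)%N & (o <= j)%N] then
    algorithm_coef q.2
      (fun r t => (o + t)%N \in reduced_assignment K conn T (o + r)%N)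
      (fun r t => H (o + r)%N (o + t)%N) (i - o) (j - o)
  else 0.

Definition network_coef (p : seq (nat * nat)) (i j : nat) : R :=
  \sum_(q <- p) subnetwork_coef q i j.

(* The users whose message is transmitted. *)
Definition network_active (p : seq (nat * nat)) : {fset nat} :=
  [fset i in users K | has (fun j => network_coef p i j != 0) (iota 1 K)]%fset.

End NetworkAlgorithm.

(* Main.v *)
Require Import Defs.
From HB Require Import structures.
From mathcomp Require Import all_boot all_order all_algebra.
From mathcomp Require Import finmap.
From mathcomp Require Import all_classical all_reals all_analysis.
From mathcomp Require Import zify.

(* Almost surely no coefficient of a link vanishes, and this is all the
   genericity needed.  As |T_i| <= 2, a reduced transmit set of user i is one of
   {i}, {i-1}, {i-1, i}, {i, i+1}, {i-2, i-1}.  In an atomic subnetwork all inner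
   links are up and nothing leaks to other subnetworks, so a set of users can be
   served there if and only if it avoids certain pairs {i, i+1} (T_i = {i} or
   T_(i+1) = {i}) and certain triples {i, i+1, i+2} (T_i = {i, i+1},
   T_(i+1) = {i, i+1} or T_(i+2) = {i, i+1}).  The algorithm is greedy for these
   conflicts: whenever it leaves user i silent, user i-1 is active, and either the
   pair {i-1, i} is forbidden, or the triple {i-2, i-1, i} is forbidden and user
   i-2 is active too.  Hence on every prefix of the subnetwork it serves at least
   as many users as any other scheme. *)

Set Implicit Arguments.
Unset Strict Implicit.
Unset Printing Implicit Defensive.

Import GRing.Theory.

(** * Greedy scheduling *)

(* The possible reduced transmit sets of user i, in this order:
   {i}, {i-1}, {i-1, i}, {i, i+1} and {i-2, i-1}. *)
Inductive kind := KOwn | KPrev | KBoth | KNext | KPrev2.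

Definition has_own t := match t with KOwn | KBoth | KNext => true | _ => false end.
Definition has_prev t := match t with KPrev | KBoth | KPrev2 => true | _ => false end.
Definition has_next t := if t is KNext then true else false.
Definition has_prev2 t := if t is KPrev2 then true else false.

(* Inside an atomic subnetwork all links are up, so a pair (resp. a triple) of
   consecutive users can be active together unless it is in conflict. *)
Definition pair_conflict t1 t2 :=
  match t1, t2 with KOwn, _ | _, KPrev => true | _, _ => false end.

Definition triple_conflict t1 t2 t3 :=
  match t1, t2, t3 with
  | KNext, _, _ | _, KBoth, _ | _, _, KPrev2 => true
  | _, _, _ => false
  end.

Definition conflict_free (N : nat) (t : nat -> kind) (s : pred nat) : Prop :=
  (forall i, 0 < i < N -> s i -> s i.+1 -> ~~ pair_conflict (t i) (t i.+1)) /\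
  (forall i, 0 < i -> i.+1 < N -> s i -> s i.+1 -> s i.+2 ->
     ~~ triple_conflict (t i) (t i.+1) (t i.+2)).

(** For users 1 and 2 the truncated predecessors are 0. Once [a 0] is false, user 1 is never blocked
    and user 2 only by a pair. *)
Definition blocked (t : nat -> kind) (a : pred nat) (i : nat) : bool :=
  a i.-1 && (pair_conflict (t i.-1) (t i) ||
             a i.-2 && triple_conflict (t i.-2) (t i.-1) (t i)).

Lemma count_iotaSr (a : pred nat) m n :
  count a (iota m n.+1) = count a (iota m n) + a (m + n).
Proof. by rewrite -addn1 iotaD count_cat /= addn0. Qed.

(* If s serves a blocked user n that a does not serve, then among the one or two
   users before n that witness the blocking, all served by a, s misses one:
   compare s and a just before these. *)
Lemma greedy_stays_ahead N t (a s : pred nat) :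
  a 0 = false ->
  (forall i, 0 < i <= N -> ~~ a i -> blocked t a i) ->
  conflict_free N t s ->
  forall n, n <= N -> count s (iota 1 n) <= count a (iota 1 n).
Proof.
move=> a0 blk [fr2 fr3]; elim/ltn_ind=> -[//|n] IH ltnN.
rewrite !count_iotaSr add1n; have IHn := IH n (ltnSn n) (ltnW ltnN).
have [an|] := boolP (a n.+1); first by move: (s n.+1) => [] /=; lia.
move/(blk n.+1 ltnN); rewrite /blocked /= => /andP[an conf].
have [sn|] := boolP (s n.+1); last by lia.
case: n an => [|n] an in ltnN IHn conf sn IH *; first by rewrite a0 in an.
rewrite !count_iotaSr add1n an.
have [sn1|_] := boolP (s n.+1); last first.
  by have := IH n (leqnSn _) (ltnW (ltnW ltnN)); lia.
case: n => [|n] in an ltnN IHn conf sn IH sn1 *.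
  by rewrite /= a0 orbF (negbTE (fr2 1%N _ sn1 sn)) // in conf.
rewrite /= (negbTE (fr2 _ _ sn1 sn)) //= in conf.
case/andP: conf => an2 conf.
rewrite !count_iotaSr add1n an2.
have [sn2|_] := boolP (s n.+1); first by rewrite (negbTE (fr3 n.+1 _ ltnN sn2 sn1 sn)) in conf.
by have := IH n ltac:(lia) ltac:(lia); lia.
Qed.

(** * The algorithm as a scan over modes *)

(* How W_i is sent: not at all, by transmitter i or i-1 alone, by i with i+1
   cancelling at receiver i+1, or by i-1 with i-2 cancelling at receiver i-1. *)
Inductive mode := Off | ViaOwn | ViaPrev | ViaNext | ViaPrev2.

Definition active m := if m is Off then false else true.
Definition sends_own m := match m with ViaOwn | ViaNext => true | _ => false end.
Definition sends_prev m := match m with ViaPrev | ViaPrev2 => true | _ => false end.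
Definition cancels_next m := if m is ViaNext then true else false.
Definition cancels_prev m := if m is ViaPrev2 then true else false.

Definition mode_bit (m : mode) (i j : nat) : bool :=
  [|| sends_own m && (j == i), sends_prev m && (j.+1 == i),
      cancels_next m && (j == i.+1) | cancels_prev m && (j.+2 == i)].

(* One round of step 3 at user i, where t2, m2 belong to user i-1, t3 to user i
   and m1 to user i-2; the result is the new mode of i-1 and the mode of i. *)
Definition advance (t2 t3 : kind) (m1 m2 : mode) : mode * mode :=
  let own_link :=
    if has_own t3 && ~~ cancels_next m1 then
      if ~~ sends_own m2 then (m2, ViaOwn)
      else if has_next t2 then (ViaNext, ViaOwn) else (m2, Off)
    else (m2, Off) in
  if has_prev t3 && ~~ sends_own m2 then
    if ~~ sends_prev m2 then (m2, ViaPrev)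
    else if has_prev2 t3 && ~~ active m1 then (m2, ViaPrev2) else own_link
  else if [&& has_prev2 t3, has_next t2 & ~~ active m1] then (ViaNext, ViaPrev2)
  else own_link.

(** Each mode relies on the silence of the one other receiver that hears the codeword uncancelled.
    [ViaNext] also records that user i+1 is active, so that a silent user i+2 is explained by a
    triple conflict. *)
Definition valid_mode (t : nat -> kind) (m : nat -> mode) (i : nat) : bool :=
  match m i with
  | Off => true
  | ViaOwn => has_own (t i) && ~~ active (m i.+1)
  | ViaPrev => has_prev (t i) && ~~ active (m i.-1)
  | ViaNext => [&& has_next (t i), active (m i.+1) & ~~ active (m i.+2)]
  | ViaPrev2 => has_prev2 (t i) && ~~ active (m i.-2)
  end.

(** The modes a user can have right after its own round. In particular [ViaNext] does not occur yet,
    and a silent user has an active predecessor. *)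
Definition last_mode_ok (t : kind) (m : mode) (prev_active : bool) : bool :=
  match t, m with
  | KOwn, ViaOwn | KNext, ViaOwn => true
  | KPrev, ViaPrev | KBoth, ViaPrev | KPrev2, ViaPrev => ~~ prev_active
  | KBoth, ViaOwn | KPrev2, ViaPrev2 | _, Off => prev_active
  | _, _ => false
  end.

(* m describes the bits s after round n; schedule_last is what the next round
   needs to know about the last user. *)
Record schedule (t : nat -> kind) (s : bits) (m : nat -> mode) (n : nat) : Prop :=
  Schedule {
    schedule_bits : forall i j, b s i j = mode_bit (m i) i j;
    schedule_active : forall i, active (m i) -> 0 < i <= n;
    schedule_valid : forall i, valid_mode t m i;
    schedule_last : last_mode_ok (t n) (m n) (active (m n.-1));
    schedule_blocked : forall i, 0 < i <= n -> ~~ active (m i) ->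
      blocked t (active \o m) i }.

(** One round involves finitely many kinds and modes, so enumeration settles it. The conclusions
    feed the invariant: earlier users keep their service, the modes of i-2, i-1 and i stay valid,
    and a silent user i is blocked. *)
Lemma advanceP t1 t2 t3 m1 m2 :
  (cancels_next m1 -> has_next t1 && active m2) ->
  (sends_own m1 -> cancels_next m1 || ~~ active m2) ->
  last_mode_ok t2 m2 (active m1) ->
  let: (m2', m3) := advance t2 t3 m1 m2 in
  [/\ active m2' = active m2, active m3 ==> ~~ cancels_next m1,
      if m2' is ViaNext then has_next t2 && active m3 else
      if m2' is ViaOwn then has_own t2 && ~~ active m3 else true,
      last_mode_ok t3 m3 (active m2) && (cancels_prev m3 ==> ~~ active m1) &
      active m3 || active m2 &&
        (pair_conflict t2 t3 || active m1 && triple_conflict t1 t2 t3)].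
Proof.
by case: t2 t3 m1 m2 t1 => [] [] [] [] [] //= H1 H2 //= _; split;
  rewrite //; move: (H1 isT) (H2 isT).
Qed.

(** A round touches user i-1 only to cancel its codeword at receiver i. So either its old validity
    carries over or its new mode is [ViaNext]. *)
Lemma advance_fst t2 t3 m1 m2 :
  (advance t2 t3 m1 m2).1 = m2 \/ (advance t2 t3 m1 m2).1 = ViaNext.
Proof. by case: t2 t3 m1 m2 => [] [] [] []; auto. Qed.

(** * From the bits of the algorithm to modes *)

Lemma b_cons k l (s : bits) i j :
  b ((k, l) :: s) i j = (i == k) && (j == l) || b s i j.
Proof. by rewrite /b in_cons xpair_eqE. Qed.

Lemma b_cat (s1 s2 : bits) i j : b (s1 ++ s2) i j = b s1 i j || b s2 i j.
Proof. by rewrite /b mem_cat. Qed.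

Definition update (m : nat -> mode) (k : nat) (mm : mode * mode) : nat -> mode :=
  fun i => if i == k then mm.1 else if i == k.+1 then mm.2 else m i.

(** A round only adds bits, all in rows [k] and [k.+1], and row [k.+1] was empty before; hence two
    rows remain to be compared. *)
Lemma bits_update (s add : bits) (m : nat -> mode) k mm :
  (forall i j, b s i j = mode_bit (m i) i j) -> m k.+1 = Off ->
  all (fun p => (p.1 == k) || (p.1 == k.+1)) add ->
  (forall j, b add k j || mode_bit (m k) k j = mode_bit mm.1 k j) ->
  (forall j, b add k.+1 j = mode_bit mm.2 k.+1 j) ->
  forall i j, b (add ++ s) i j = mode_bit (update m k mm i) i j.
Proof.
move=> bE mk sub Hk Hk1 i j; rewrite b_cat /update bE.
case: (i =P k) => [->|/eqP/negbTE ik]; first exact: Hk.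
case: (i =P k.+1) => [->|/eqP/negbTE ik1]; first by rewrite Hk1 mk orbF.
suff -> : b add i j = false by [].
by apply/negP => /(allP sub) /=; rewrite ik ik1.
Qed.

Lemma neqSn n : (n == n.+1) = false. Proof. exact: ltn_eqF. Qed.
Lemma neqSSn n : (n == n.+2) = false. Proof. exact: ltn_eqF. Qed.
Lemma neqnS n : (n.+1 == n) = false. Proof. exact: gtn_eqF. Qed.
Lemma neqnSS n : (n.+2 == n) = false. Proof. exact: gtn_eqF. Qed.
Lemma neqSSSn n : (n == n.+3) = false. Proof. exact: (ltn_eqF (leqW (leqnSn n.+1))). Qed.
Lemma neqnSSS n : (n.+3 == n) = false. Proof. exact: (gtn_eqF (leqW (leqnSn n.+1))). Qed.
Definition neqE := (eqSS, neqSn, neqSSn, neqSSSn, neqnS, neqnSS, neqnSSS).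

Lemma mode_bit_own m i : mode_bit m i i = sends_own m.
Proof. by rewrite /mode_bit eqxx !neqE !andbF !orbF andbT. Qed.

Lemma mode_bit_prev m i : mode_bit m i.+1 i = sends_prev m.
Proof. by rewrite /mode_bit eqxx !neqE !andbF !orbF andbT. Qed.

Lemma mode_bit_next m i : mode_bit m i i.+1 = cancels_next m.
Proof. by rewrite /mode_bit eqxx !neqE !andbF !orbF andbT. Qed.

Lemma mode_bit_prev2 m i : mode_bit m i.+2 i = cancels_prev m.
Proof. by rewrite /mode_bit eqxx !neqE !andbF andbT. Qed.

Lemma active_sends m : active m = sends_own m || sends_prev m.
Proof. by case: m. Qed.

Lemma step3_bits (has_msg : rel nat) (t : nat -> kind) (s : bits) (m : nat -> mode) n :
  has_msg n.+3 n.+3 = has_own (t n.+3) -> has_msg n.+3 n.+2 = has_prev (t n.+3) ->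
  has_msg n.+3 n.+1 = has_prev2 (t n.+3) -> has_msg n.+2 n.+3 = has_next (t n.+2) ->
  (forall i j, b s i j = mode_bit (m i) i j) -> m n.+3 = Off ->
  last_mode_ok (t n.+2) (m n.+2) (active (m n.+1)) ->
  forall i j, b (step3b has_msg (step3a has_msg s n.+3) n.+3) i j =
    mode_bit (update m n.+2 (advance (t n.+2) (t n.+3) (m n.+1) (m n.+2)) i) i j.
Proof.
move=> hown hprev hprev2 hnext bE m3 ok.
have E3 : (n.+3 - 1 = n.+2)%N by rewrite subn1.
have E4 : (n.+3 - 2 = n.+1)%N by rewrite subn2.
have E5 : (n.+3 - 3 = n)%N by rewrite subSS subSS subSS subn0.
have bown k : b s k k = sends_own (m k) by rewrite bE mode_bit_own.
have bprev k : b s k.+1 k = sends_prev (m k.+1) by rewrite bE mode_bit_prev.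
have bnext k : b s k k.+1 = cancels_next (m k) by rewrite bE mode_bit_next.
have upd := bits_update bE m3.
(* The bits that the round puts in front of [s], following the branches of [advance]. *)
pose own_add := (if has_own (t n.+3) && ~~ cancels_next (m n.+1) then
      if ~~ sends_own (m n.+2) then [:: (n.+3, n.+3)]
      else if has_next (t n.+2) then [:: (n.+3, n.+3); (n.+2, n.+3)] else [::]
    else [::]) : bits.
pose add := (if has_prev (t n.+3) && ~~ sends_own (m n.+2) then
    if ~~ sends_prev (m n.+2) then [:: (n.+3, n.+2)]
    else if has_prev2 (t n.+3) && ~~ active (m n.+1) then [:: (n.+3, n.+2); (n.+3, n.+1)]
    else own_add
  else if [&& has_prev2 (t n.+3), has_next (t n.+2) & ~~ active (m n.+1)] then
    [:: (n.+3, n.+2); (n.+3, n.+1); (n.+2, n.+3); (n.+2, n.+2)]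
  else own_add) : bits.
have -> : step3b has_msg (step3a has_msg s n.+3) n.+3 = add ++ s.
  rewrite /add /own_add /step3b /step3a E3 E4 E5 hown hprev hprev2 hnext !bown !bprev.
  (* The two tests on the row of user i-2 in step 3a say together that this user is silent. *)
  rewrite active_sends negb_or [~~ sends_prev (m n.+1) && _]andbC.
  have m3p : sends_prev (m n.+3) = false by rewrite m3.
  case: (has_prev (t n.+3) && _).
    case: (~~ sends_prev (m n.+2)); first by rewrite !b_cons !eqxx andbF.
    case: (has_prev2 (t n.+3) && _); first by rewrite !b_cons !eqxx andbF.
    rewrite bown bprev bnext m3p /=; case: (has_own _ && _) => //.
    by case: (~~ _) => //; case: (has_next _).
  case: [&& has_prev2 _, has_next _ & _]; first by rewrite !b_cons !eqxx andbF.
  rewrite bown bprev bnext m3p /=; case: (has_own _ && _) => //.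
  by case: (~~ _) => //; case: (has_next _).
apply: upd => [|j|j].
- by rewrite /add /own_add; do !case: ifP => _ //=; rewrite !eqxx ?orbT.
(* Adding the bit (i-1, i) turns [ViaOwn] into [ViaNext], so user i-1 has to be in mode [ViaOwn]
   before; the invariant on the last mode ensures this in both branches that add the bit. *)
- have m2own : sends_own (m n.+2) -> m n.+2 = ViaOwn.
    by move: ok; case: (t _) (m n.+2) => [] [].
  have m2next : has_next (t n.+2) -> ~~ active (m n.+1) -> m n.+2 = ViaOwn.
    by move: ok; case: (t _) (m n.+2) => [] [] //= ->.
  have own_case : b own_add n.+2 j || mode_bit (m n.+2) n.+2 j = mode_bit
      (if has_own (t n.+3) && ~~ cancels_next (m n.+1) then
         if ~~ sends_own (m n.+2) then (m n.+2, ViaOwn)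
         else if has_next (t n.+2) then (ViaNext, ViaOwn) else (m n.+2, Off)
       else (m n.+2, Off)).1 n.+2 j.
    rewrite /own_add; case: (has_own _ && _) => //.
    case: (boolP (sends_own _)) => [/m2own ->|_] /=; last by rewrite b_cons !neqE.
    case: (has_next _) => //=.
    by rewrite !b_cons !neqE eqxx /mode_bit /= !orbF orbC.
  rewrite /add /advance; case: (has_prev _ && _).
    case: (~~ _); first by rewrite !b_cons !neqE.
    by case: (_ && _) => //; rewrite !b_cons !neqE.
  case: ifP => // /and3P[_ next /(m2next next) ->].
  by rewrite !b_cons !neqE eqxx /mode_bit /= !orbF; case: (j == n.+3); case: (j == n.+2).
- rewrite /add /own_add /advance.
  by do !case: ifP => _ //=; rewrite ?b_cons ?neqE ?eqxx /mode_bit /= ?eqSS ?orbF.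
Qed.

Lemma schedule_off t s m n i : schedule t s m n -> n < i -> m i = Off.
Proof.
move=> sch lt_ni; have := schedule_active sch (i := i).
by case: (m i) => // /(_ isT) /andP[_]; rewrite leqNgt lt_ni.
Qed.

(** The new bits are arbitrary up to their description by modes, so that the same induction step
    covers step 2, with user 0 as a silent user, and step 3. *)
Lemma schedule_step (t : nat -> kind) (s s' : bits) (m : nat -> mode) n
    (mm := advance (t n.+1) (t n.+2) (m n) (m n.+1)) :
  schedule t s m n.+1 ->
  (forall i j, b s' i j = mode_bit (update m n.+1 mm i) i j) ->
  schedule t s' (update m n.+1 mm) n.+2.
Proof.
rewrite {}/mm => sch bE.
have off i : n.+1 < i -> m i = Off by exact: schedule_off sch.
have m3 := off n.+2 (ltnSn _).
have last := schedule_last sch; rewrite /= in last.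
have V1 := schedule_valid sch n.
have V2 := schedule_valid sch n.+1.
have c1 : cancels_next (m n) -> has_next (t n) && active (m n.+1).
  by move: V1; rewrite /valid_mode /=; case: (m n) => //= /and3P[-> ->].
have c2 : sends_own (m n) -> cancels_next (m n) || ~~ active (m n.+1).
  by move: V1; rewrite /valid_mode /=; case: (m n) => //= /andP[].
have adv := advanceP (t n.+2) c1 c2 last.
have fst := advance_fst (t n.+1) (t n.+2) (m n) (m n.+1).
case: advance fst bE adv => m2' m3' /= fst bE [act2 act3 new2 /andP[new3 far3] blk].
set m' := update m n.+1 (m2', m3') in bE *.
have m'3 : m' n.+2 = m3' by rewrite /m' /update !neqE eqxx.
have m'2 : m' n.+1 = m2' by rewrite /m' /update eqxx.
have m'E i : i != n.+1 -> i != n.+2 -> m' i = m i.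
  by rewrite /m' /update => /negbTE -> /negbTE ->.
have m'lt i : i < n.+1 -> m' i = m i.
  by move=> lt; rewrite m'E // ltn_eqF // ltnW.
have m'gt i : n.+2 < i -> m' i = Off.
  by move=> lt; rewrite m'E ?off ?gtn_eqF // ltnW.
have act' i : i <= n.+1 -> active (m' i) = active (m i).
  by rewrite leq_eqVlt => /predU1P[->|/m'lt ->//]; rewrite m'2.
split=> // [i|i||i].
- case: (ltngtP i n.+2) => [lt | /m'gt -> // | -> //]; rewrite act' // => /(schedule_active sch).
  by case/andP=> ->.
- rewrite /valid_mode; case: (ltngtP i n.+2) => [ | /m'gt -> // | ->]; last first.
    rewrite m'3 /= (m'gt n.+3) // (m'gt n.+4) ?leqnSn // m'2 m'lt // act2.
    by move: new3 far3; case: (m3'); case: (t n.+2) => //= ->.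
  rewrite ltnS leq_eqVlt => /predU1P[->|].
    rewrite m'2 /= m'3 (m'gt n.+3) // andbT [m' n]m'lt // [m' n.-1]m'lt ?ltnS ?leq_pred //.
    case: fst new2 V2 => [->|->] //; rewrite /valid_mode /=.
    by case: (m n.+1).
  move=> lt; rewrite m'lt //; have := schedule_valid sch i; rewrite /valid_mode.
  have le_in : i <= n.+1 by exact: ltnW.
  rewrite (act' i.+1) // (act' i.-1) ?(leq_trans (leq_pred i)) //.
  rewrite (act' i.-2) -?subn2 ?(leq_trans (leq_subr _ _)) // subn2.
  (* Among the users before i-1, only i-2 has the new user in its condition, as its second
     successor; [act3] keeps the new user silent if i-2 is in mode [ViaNext]. *)
  move: lt; rewrite ltnS leq_eqVlt => /predU1P[->|lt]; last by rewrite act'.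
  by move: act3; rewrite m'3 m3; case: (m n) => //=; case: (active m3').
- by rewrite /= m'3 m'2 act2.
- case/andP=> i0; rewrite leq_eqVlt => /predU1P[->|lt].
    by rewrite m'3 /blocked /= m'2 m'lt // act2 => /negbTE n3; rewrite n3 in blk.
  rewrite act' // => /(schedule_blocked sch).
  rewrite i0 -ltnS lt => /(_ isT); rewrite /blocked /= !act' //.
    by apply: leq_trans (_ : i <= _) => //; rewrite -subn2 leq_subr.
  by apply: leq_trans (leq_pred _) _.
Qed.

Definition mode1 (t : nat -> kind) : nat -> mode :=
  fun i => if i == 1 then if has_prev (t 1) then ViaPrev else ViaOwn else Off.

(** * The run of the algorithm on one subnetwork *)

Section Run.
Variables (R : fieldType) (N : nat) (has_msg : rel nat) (H : nat -> nat -> R).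
Variable t : nat -> kind.
Local Open Scope ring_scope.

Record kinds_of : Prop := KindsOf {
  kind_own : forall i, (0 < i <= N)%N -> has_msg i i = has_own (t i);
  kind_prev : forall i, (i < N)%N -> has_msg i.+1 i = has_prev (t i.+1);
  kind_prev2 : forall i, (i.+1 < N)%N -> has_msg i.+2 i = has_prev2 (t i.+2);
  kind_next : forall i, (0 < i < N)%N -> has_msg i i.+1 = has_next (t i);
  kind_first : ~~ has_prev2 (t 1);
  kind_last : ~~ has_next (t N) }.

(** The links at the outer transmitters 0 and [N] may be erased, so they are only claimed where a
    transmit set uses them. The denominators of the cancelling coefficients are covered by
    [link_prev2] and [link_next]. *)
Record links_of : Prop := LinksOf {
  link_own : forall i, (0 < i <= N)%N -> has_own (t i) -> H i i != 0;
  link_prev : forall i, (i < N)%N -> has_prev (t i.+1) -> H i.+1 i != 0;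
  link_prev2 : forall i, (i.+1 < N)%N -> has_prev2 (t i.+2) -> H i.+1 i != 0;
  link_inner_own : forall i, (0 < i < N)%N -> H i i != 0;
  link_inner_prev : forall i, (0 < i < N)%N -> H i.+1 i != 0;
  link_next : forall i, (0 < i < N)%N -> has_next (t i) -> H i.+1 i.+1 != 0 }.

Hypotheses (kinds : kinds_of) (links : links_of) (N_gt0 : (0 < N)%N).

Lemma schedule1 : schedule t (step1 has_msg H) (mode1 t) 1.
Proof.
have -> : step1 has_msg H = if has_prev (t 1) then [:: (1, 0)%N] else [:: (1, 1)%N].
  rewrite /step1 (kind_prev kinds) //; case: ifP => [/andP[_ ->//]|].
  by case: ifP => // p1; rewrite (link_prev links).
have := kind_first kinds; split => [i j|i|i||i].
- rewrite /mode1; case: ifP; case: (i =P 1%N) => [->|/eqP/negbTE i1] _;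
    by rewrite b_cons ?i1 //= /mode_bit /= /b in_nil !orbF ?eqSS //.
- by rewrite /mode1; case: eqP => [->|].
- rewrite /valid_mode /mode1; case: eqP => [->|//].
  by case: (t 1) H0.
- by rewrite /mode1 /=; case: (t 1) H0.
- by rewrite /mode1; case: i => [|[|i]] //=; case: (has_prev _).
Qed.

(** Step 2 is a round of step 3 with a silent user 0: its tests of [H 1 0] succeed whenever
    transmitter 0 serves user 1 or 2. *)
Lemma schedule2 : (1 < N)%N -> exists m,
  schedule t (step2b has_msg (step2a has_msg H (step1 has_msg H))) m 2.
Proof.
move=> N1; exists (update (mode1 t) 1 (advance (t 1) (t 2) (mode1 t 0) (mode1 t 1))).
apply: (schedule_step schedule1) => i j /=.
have h10 : has_prev (t 1) || has_prev2 (t 2) -> H 1 0 != 0.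
  by case/orP => [/(link_prev links)|/(link_prev2 links)]; apply.
have kE := (kind_own kinds, kind_prev kinds, kind_prev2 kinds, kind_next kinds).
move: h10 (kind_first kinds); rewrite /step2b /step2a /step1 !kE // /mode1 /=.
rewrite /update; case: (i =P 1%N) => [->|/eqP/negbTE i1]; [|case: (i =P 2) => [->|/eqP/negbTE i2]].
all: case: (t 1); case: (t 2) => //= h10 _; try rewrite (h10 isT); rewrite ?andbF ?andbT //=.
all: rewrite ?b_cons /b ?in_nil ?in_cons ?xpair_eqE ?i1 ?i2 /mode_bit /= ?eqSS ?orbF ?andbF //=.
all: by case: j => [|[|[|j]]].
Qed.

Lemma schedule_run : exists m, schedule t (algorithm_bits N has_msg H) m N.
Proof.
rewrite /algorithm_bits; case: (leqP 2 N) => N2; last first.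
  have -> : N = 1%N by apply/eqP; rewrite eqn_leq N_gt0 andbT -ltnS.
  by exists (mode1 t); apply: schedule1.
suff run n : (n.+2 <= N)%N -> exists m, schedule t
    (foldl (fun s i => step3b has_msg (step3a has_msg s i) i)
      (step2b has_msg (step2a has_msg H (step1 has_msg H))) (iota 3 n)) m n.+2.
  by have := run (N - 2)%N; rewrite -addn2 subnK //; apply.
elim: n => [|n IH] lt_nN; first exact: schedule2.
have [m sch] := IH (ltnW lt_nN).
have -> : iota 3 n.+1 = iota 3 n ++ [:: n.+3] by rewrite -(addn1 n) iotaD addn1.
rewrite foldl_cat /=.
eexists; apply: (schedule_step sch); apply: step3_bits.
- exact: (kind_own kinds).
- exact: (kind_prev kinds).
- exact: (kind_prev2 kinds).
- by apply: (kind_next kinds); rewrite /= ?(ltnW lt_nN).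
- exact: schedule_bits sch.
- exact: (schedule_off sch).
- exact: (schedule_last sch).
Qed.
End Run.

(** * Beam coefficients *)

Section Coefficients.
Variables (R : fieldType) (N : nat) (has_msg : rel nat) (H : nat -> nat -> R).
Variable t : nat -> kind.
Local Open Scope ring_scope.

(** The ratios solve the zero-forcing equation at receiver i+1 for [ViaNext] and at receiver i-1 for
    [ViaPrev2]. *)
Definition beam (m : mode) (i j : nat) : R :=
  match m with
  | Off => 0
  | ViaOwn => (i == j)%:R
  | ViaPrev => (i == j.+1)%:R
  | ViaNext => (i == j)%:R - (i.+1 == j)%:R * (H i.+1 i / H i.+1 i.+1)
  | ViaPrev2 => (i == j.+1)%:R - (i == j.+2)%:R * (H i.-1 i.-1 / H i.-1 i.-2)
  end.

Hypotheses (kinds : kinds_of N has_msg t) (links : links_of N H t) (N_gt0 : (0 < N)%N).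
Variable m : nat -> mode.
Hypothesis sch : schedule t (algorithm_bits N has_msg H) m N.

Lemma cancels_prev_gt1 i : m i = ViaPrev2 -> (1 < i)%N.
Proof.
move=> mi; have := schedule_valid sch i; rewrite /valid_mode mi => /andP[p2 _].
have := schedule_active sch (i := i); rewrite mi => /(_ isT) /andP[i0 _].
by case: i i0 {mi} p2 => [|[|i]] //; rewrite (negbTE (kind_first kinds)).
Qed.

Lemma cancels_next_ltN i : m i = ViaNext -> (0 < i < N)%N.
Proof.
move=> mi; have := schedule_valid sch i; rewrite /valid_mode mi => /andP[nx _].
have := schedule_active sch (i := i); rewrite mi => /(_ isT) /andP[i0 iN].
rewrite i0 ltn_neqAle iN andbT; apply: contraL nx => /eqP ->.
exact: kind_last kinds.
Qed.

(** This shows that the guard on the output, in particular the one on [X_N], never suppresses a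
    coefficient that a mode calls for. *)
Lemma beam_neq0 i j : (0 < i <= N)%N -> beam (m i) i j != 0 ->
  [/\ (j <= N)%N, has_msg i j & j = N -> H N N != 0].
Proof.
move=> /andP[i0 iN]; have := schedule_valid sch i.
rewrite /valid_mode /beam; case mi: (m i) => [||||].
- by rewrite eqxx.
- case: (i =P j) => [<-|_]; rewrite ?eqxx ?andbF // => /andP[own _] _.
  split=> //; first by rewrite (kind_own kinds) ?i0.
  by move=> iE; rewrite -iE (link_own links) // i0 iN.
- case: (i =P j.+1) => [iE|_]; rewrite ?eqxx ?andbF // => /andP[prev _] _; rewrite iE in iN prev *.
  split=> [||jN]; [exact: ltnW | by rewrite (kind_prev kinds) |].
  by rewrite jN ltnn in iN.
- have iN' := cancels_next_ltN mi; case/and3P=> next _ _.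
  have own : has_own (t i) by case: (t i) next.
  case: (i =P j) => [<- _|_].
    split=> //; first by rewrite (kind_own kinds) ?i0.
    by move=> iE; rewrite iE ltnn andbF in iN'.
  rewrite sub0r oppr_eq0; case: (i.+1 =P j) => [<- _|]; last by rewrite mul0r eqxx.
  split; [by case/andP: iN' | by rewrite (kind_next kinds) |].
  by move=> <-; apply: (link_next links).
- have := cancels_prev_gt1 mi; case: i => [|[|i]] // in i0 iN mi * => _ /andP[prev2 _].
  have prev : has_prev (t i.+2) by case: (t i.+2) prev2.
  rewrite !eqSS; case: (i.+1 =P j) => [<- _|_].
    split=> [||jN]; [exact: ltnW | by rewrite (kind_prev kinds) |].
    by rewrite jN ltnn in iN.
  rewrite sub0r oppr_eq0; case: (i =P j) => [<- _|]; last by rewrite mul0r eqxx.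
  split=> [||jN]; [exact/ltnW/ltnW | by rewrite (kind_prev2 kinds) |].
  by move: iN; rewrite jN ltnNge leqnSn.
Qed.

Lemma algorithm_coefE i j : (0 < i <= N)%N ->
  algorithm_coef N has_msg H i j = beam (m i) i j.
Proof.
move=> iN; rewrite /algorithm_coef iN /=.
suff bmE : (b (algorithm_bits N has_msg H) j j && (i == j))%:R
    + (b (algorithm_bits N has_msg H) j.+1 j && (i == j.+1))%:R
    - (b (algorithm_bits N has_msg H) j.-1 j && (i.+1 == j))%:R * (H j j.-1 / H j j)
    - (b (algorithm_bits N has_msg H) j.+2 j && (i == j.+2))%:R
        * (H j.+1 j.+1 / H j.+1 j) = beam (m i) i j.
  rewrite bmE; case: ifPn => // guard; apply/esym/eqP; apply: contraNT guard.
  case/(beam_neq0 iN) => -> _ jN /=; case: eqP => //= /jN; exact.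
have bE := schedule_bits sch; rewrite !bE.
(* Each term of the output compares i with a shift of j, so all four bits can be read off the mode
   of user i alone. *)
have -> : mode_bit (m j) j j && (i == j) = sends_own (m i) && (i == j).
  by case: (i =P j) => [->|]; rewrite ?mode_bit_own // !andbF.
have -> : mode_bit (m j.+1) j.+1 j && (i == j.+1) = sends_prev (m i) && (i == j.+1).
  by case: (i =P j.+1) => [->|]; rewrite ?mode_bit_prev // !andbF.
have -> : mode_bit (m j.-1) j.-1 j && (i.+1 == j) = cancels_next (m i) && (i.+1 == j).
  by case: (i.+1 =P j) => [<-|]; rewrite ?mode_bit_next // !andbF.
have -> : mode_bit (m j.+2) j.+2 j && (i == j.+2) = cancels_prev (m i) && (i == j.+2).
  by case: (i =P j.+2) => [->|]; rewrite ?mode_bit_prev2 // !andbF.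
rewrite /beam; case: (m i) => /=; rewrite ?mulr0n ?mul0r ?subr0 ?addr0 ?add0r //.
  by case: (i.+1 =P j) => [<-//|_]; rewrite !mul0r.
by case: (i =P j.+2) => [->//|_]; rewrite !mul0r.
Qed.

Lemma active_desired i : active (m i) ->
  H i i.-1 * beam (m i) i i.-1 + H i i * beam (m i) i i != 0.
Proof.
move=> ai; have iN := schedule_active sch ai.
have := schedule_valid sch i; rewrite /valid_mode.
case: i => // i in ai iN *; rewrite /= /beam; case mi: (m i.+1) ai => //= _.
- case/andP=> own _; rewrite eqxx !neqE mulr0 add0r mulr1.
  exact: link_own links _ _ own.
- case/andP=> prev _; rewrite eqxx !neqE mulr0 addr0 mulr1.
  exact: link_prev links _ _ prev.
- case/and3P=> next _ _; rewrite eqxx !neqE /= ?mulr0n ?mulr1n !mul0r !subr0 mulr0 add0r mulr1.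
  by apply: link_own links _ iN _; case: (t i.+1) next.
- case/andP=> prev2 _; rewrite eqxx !neqE /= ?mulr0n ?mulr1n !mul0r !subr0 mulr0 addr0 mulr1.
  by apply: link_prev links _ iN _; case: (t i.+1) prev2.
Qed.

(** Receiver [k] hears transmitters k-1 and k only. A codeword of another user that gets there
    either meets a receiver which [valid_mode] declares silent, a contradiction, or is cancelled by
    the ratio in [beam]. *)
Lemma active_interference i k : active (m i) -> active (m k) -> k != i ->
  H k k.-1 * beam (m i) i k.-1 + H k k * beam (m i) i k = 0.
Proof.
move=> ai ak ki; have iN := schedule_active sch ai.
have kN := schedule_active sch ak.
case: k => // k in ak ki kN *; rewrite eq_sym in ki; rewrite [k.+1.-1]/=.
have := schedule_valid sch i; rewrite /valid_mode.
rewrite /beam; case mi: (m i) ai => //= _.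
- case/andP=> _ off; rewrite (negbTE ki) mulr0 addr0.
  by case: (i =P k) => [iE|]; rewrite ?mulr0 //; rewrite iE ak in off.
- case/andP=> _ off; rewrite (negbTE ki) mulr0 add0r.
  by case: (i =P k.+2) => [iE|]; rewrite ?mulr0 //; rewrite iE ak in off.
- have iN' := cancels_next_ltN mi; case/and3P=> next _ off; rewrite (negbTE ki) eqSS.
  have -> : (i.+1 == k) = false by apply: contraNF off => /eqP ->.
  case: (i =P k) => [iE|_]; last by rewrite !mul0r !subr0 !mulr0 addr0.
  rewrite -iE.
  rewrite mul0r subr0 sub0r mulr1 mul1r mulrN mulrCA mulfV ?mulr1 ?subrr //.
  by apply: (link_next links).
- case/andP=> prev2 off; have := cancels_prev_gt1 mi.
  case: i => [|[|i]] // in mi ki iN prev2 off * => _; rewrite !eqSS in ki *.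
  rewrite (negbTE ki); rewrite /= in off.
  have -> : (i == k.+1) = false by apply: contraNF off => /eqP ->.
  case: (i =P k) => [iE|_]; last by rewrite !mul0r !subr0 !mulr0 addr0.
  rewrite -iE.
  rewrite mul0r subr0 sub0r mulr1 mul1r mulrN mulrCA mulfV ?mulr1 ?addNr //.
  by apply: (link_prev2 links).
Qed.
End Coefficients.

(** * Atomic subnetworks *)

(** Two vertices leave no room for an intermediate one on a path. For the assignment graphs this
    reduces usefulness to a single adjacency with a marked vertex. *)
Lemma connect_card2 (V : finType) (e : rel V) (x y : V) :
  #|V| <= 2 -> connect e x y -> (x == y) || e x y.
Proof.
move=> V2 /connectP[p]; elim: p x => [|z p IH] x /=; first by move=> _ ->; rewrite eqxx.
case/andP=> exz pz yE; have := IH z pz yE.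
case: (eqVneq x y) => //= xy; case: (eqVneq z y) => [<- //|zy /= ezy].
case: (eqVneq z x) => [<- //|zx].
have u : uniq [:: x; y; z] by rewrite /= !inE negb_or xy eq_sym zx eq_sym zy.
by have := leq_trans (max_card (mem [:: x; y; z])) V2; rewrite (card_uniqP u).
Qed.

Lemma mem_users K i : (i \in users K) = (0 < i <= K).
Proof. by rewrite /users !inE /= mem_iota add1n ltnS. Qed.

(** * Topology-reduced transmit sets *)

Section Topology.
Variables (K : nat) (conn : rel nat) (T : nat -> {fset nat}).
Hypothesis conn_users : forall i j, conn i j -> i \in users K /\ j \in users K.
Hypothesis conn_near : forall i j, conn i j -> j = i \/ j.+1 = i.
Hypothesis T_users : forall i, i \in users K -> (T i `<=` users K)%fset.
Hypothesis T_card : forall i, i \in users K -> (#|` T i| <= 2)%N.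

Let conn' := reduced_conn conn T.
Let T' := reduced_assignment K conn T.

Lemma reduced_conn_conn i j : conn' i j -> conn i j.
Proof. by case/andP. Qed.

Lemma mem_reduced i x : (x \in T' i) = (x \in T i) && useful K conn' T i x.
Proof. by rewrite /T' /reduced_assignment !inE. Qed.

Lemma marked_useful i x : x \in T i -> marked conn' i x -> x \in T' i.
Proof.
move=> xT mx; rewrite mem_reduced xT; apply/existsP; exists [` xT]%fset.
by apply/existsP; exists [` xT]%fset; rewrite eqxx mx connect0.
Qed.

Lemma common_receiver_useful i x y :
  x \in T i -> y \in T' i -> common_receiver K conn' x y -> x \in T' i.
Proof.
move=> xT; rewrite !mem_reduced xT => /andP[yT] /existsP[y' /existsP[z /and3P[/eqP <- mz cz]]] xy.
apply/existsP; exists [` xT]%fset; apply/existsP; exists z; rewrite eqxx mz /=.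
by apply: connect_trans cz; apply: connect1.
Qed.

Lemma usefulP i x : i \in users K -> x \in T' i ->
  exists2 y, y \in T' i & marked conn' i y /\ ((x == y) || common_receiver K conn' x y).
Proof.
move=> iK; rewrite mem_reduced => /andP[xT] /existsP[x' /existsP[y /and3P[/eqP xE my cy]]].
exists (val y); first by apply: marked_useful => //; apply: valP.
split=> //; have := connect_card2 _ cy; rewrite -cardfE.
by move=> /(_ (T_card iK)); rewrite -val_eqE /= xE; case/orP => [-> //|];
  rewrite /assignment_graph /= xE => ->; rewrite orbT.
Qed.

(** A marked transmitter is i or i-1, and two distinct transmitters with a common receiver have
    successive labels. This leaves four positions, each with the links that made it useful. *)
Lemma reducedP i x : i \in users K -> x \in T' i ->
  [\/ x = i /\ conn' i i, x.+1 = i /\ conn' i x,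
      x = i.+1 /\ [/\ i \in T' i, conn' i i, conn' i.+1 i & conn' i.+1 i.+1] |
      x.+2 = i /\ [/\ x.+1 \in T' i, conn' i x.+1, conn' x.+1 x.+1 & conn' x.+1 x]].
Proof.
move=> iK /(usefulP iK) [y yT' [/andP[yi ciy]]].
case/orP => [/eqP xy|/hasP[r _ /andP[crx cry]]].
  by case/orP: yi => /eqP yi; [constructor 1|constructor 2]; rewrite xy yi in ciy *.
have [xr|xr] := conn_near (reduced_conn_conn crx);
  have [yr|yr] := conn_near (reduced_conn_conn cry);
  case/orP: yi => /eqP yi; subst.
- by constructor 1.
- by constructor 2.
- by constructor 3.
- by constructor 1.
- by constructor 2.
- by constructor 4.
- by case: yr => <-; constructor 1.
- by case: yr crx => <- crx; constructor 2.
Qed.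

Lemma reduced_users i x : i \in users K -> x \in T' i -> x \in users K.
Proof. by move=> iK; rewrite mem_reduced => /andP[xT _]; apply: (fsubsetP (T_users iK)). Qed.

Lemma reduced_le2 i x y z : i \in users K -> x \in T' i -> y \in T' i -> z \in T' i ->
  uniq [:: x; y; z] -> False.
Proof.
move=> iK; rewrite !mem_reduced => /andP[xT _] /andP[yT _] /andP[zT _] u.
have sub : {subset [:: x; y; z] <= T i} by move=> w; rewrite !inE => /or3P[] /eqP ->.
by have := leq_trans (uniq_leq_size u sub) (T_card iK).
Qed.

(** The outer transmitters are tested first, since i+1 forces i, and i-2 forces i-1, into the set
    and fills it. The truncation of [i.-2] to 0 is harmless, as 0 is not a transmitter of the
    network. *)
Definition kind_at (i : nat) : kind :=
  if i.+1 \in T' i then KNext else if i.-2 \in T' i then KPrev2 else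
  if i \in T' i then if i.-1 \in T' i then KBoth else KOwn else KPrev.

Lemma enabled_marked i : i \in users K -> enabled conn T i ->
  (i \in T' i) || (i.-1 \in T' i).
Proof.
move=> iK en; case/hasP: (en) => x xT cix.
have cix' : conn' i x by rewrite /conn' /reduced_conn en.
have xT' : x \in T' i.
  apply: marked_useful => //; rewrite /marked cix'.
  by case: (conn_near cix) => [->|->]; rewrite eqxx ?orbT.
by case: (conn_near cix) xT' => [->|<-] /= ->; rewrite ?orbT.
Qed.

Lemma kind_atP i : i \in users K -> enabled conn T i ->
  [/\ has_own (kind_at i) = (i \in T' i), has_prev (kind_at i) = (i.-1 \in T' i),
      has_prev2 (kind_at i) = (i.-2 \in T' i) &
      has_next (kind_at i) = (i.+1 \in T' i)].
Proof.
move=> iK en; have mk := enabled_marked iK en.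
have i0 : 0 < i by move: iK; rewrite mem_users => /andP[].
have no0 : 0 \in T' i = false.
  by apply/negP => /(reduced_users iK); rewrite mem_users.
(* Transmitter i+1 is useful only through transmitter i; a third element would exceed the
   cooperation order. The next claim is the mirror image for i-2 and i-1. *)
have next x : i.+1 \in T' i -> x \in T' i -> x = i \/ x = i.+1.
  move=> nT xT; case: (reducedP iK nT) => [[/eqP]|[/eqP]|[_ [iT _ _ _]]|[/eqP]]; rewrite ?neqE //.
  case: (eqVneq x i) => [|xi]; first by left.
  case: (eqVneq x i.+1) => [|xi1]; first by right.
  by case: (reduced_le2 iK xT iT nT); rewrite /= !inE negb_or xi xi1 neqE.
have prev2 x y : y.+2 = i -> y \in T' i -> x \in T' i -> x = y \/ x = y.+1.
  move=> yi yT xT.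
  case: (reducedP iK yT) => [[/eqP]|[/eqP]|[/eqP]|[_ [iT _ _ _]]]; rewrite -?yi ?neqE //.
  case: (eqVneq x y) => [|xy]; first by left.
  case: (eqVneq x y.+1) => [|xi1]; first by right.
  by case: (reduced_le2 iK xT yT iT); rewrite /= !inE negb_or xy xi1 neqE.
case: i => // i in iK en mk i0 no0 next prev2 *.
rewrite /kind_at [i.+1.-1]/= [i.+1.-2]/=.
case: ifP => [nT|nT].
  have iT : i.+1 \in T' i.+1.
    by case: (reducedP iK nT) => [[/eqP]|[/eqP]|[_ []]|[/eqP]]; rewrite ?neqE.
  have no x : x <= i -> x \in T' i.+1 = false.
    by move=> xi; apply/negP => /(next _ nT)[] xE; move: xi; rewrite xE ltnNge ?leqnn ?leqnSn.
  by split; rewrite /= ?iT ?no ?leq_pred.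
case: ifP => [pT|pT].
  case: i => [|i] in iK en mk {i0} no0 next prev2 nT pT *; first by rewrite no0 in pT.
  rewrite /= in pT *; have no x : i.+1 < x -> x \in T' i.+2 = false.
    move=> ix; apply/negP => /(prev2 _ _ erefl pT)[] xE;
      by move: ix; rewrite xE ltnNge ?leqnn ?leqnSn.
  have iT : i.+1 \in T' i.+2.
    by case: (reducedP iK pT) => [[/eqP]|[/eqP]|[/eqP]|[_ []]]; rewrite ?neqE.
  by split; rewrite /= ?iT ?no.
rewrite /= in mk; case: ifP mk => [iT|iT] /= mk; last by split; rewrite /= ?iT ?mk ?pT ?nT.
by case: ifP => jT; split; rewrite /= ?iT ?jT ?pT ?nT.
Qed.

Lemma kind_support i x : i \in users K -> enabled conn T i -> x \in T' i ->
  match kind_at i with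
  | KOwn => x = i
  | KPrev => x.+1 = i
  | KBoth => x = i \/ x.+1 = i
  | KNext => x = i \/ x = i.+1
  | KPrev2 => x.+1 = i \/ x.+2 = i
  end.
Proof.
move=> iK en xT; have [own prev prev2 next] := kind_atP iK en.
case: (reducedP iK xT) => [[xE _]|[xE _]|[xE _]|[xE _]].
- by subst x; move: own; rewrite xT; case: (kind_at i) => //; auto.
- by subst i; move: prev; rewrite /= xT; case: (kind_at x.+1) => //; auto.
- by subst x; move: next; rewrite xT; case: (kind_at i) => //; auto.
- by subst i; move: prev2; rewrite /= xT; case: (kind_at x.+2) => //; auto.
Qed.

(** If no boundary precedes user t+1, some useful assignment crosses it: a message of a user up to t
    heard by receiver t+1, or a later message heard by a receiver up to t. By [reducedP], every such
    crossing requires both links of transmitter [t]. *)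
Lemma inner_links t : 0 < t -> t < K -> ~~ boundary K conn T t.+1 ->
  [/\ enabled conn T t.+1, conn' t t & conn' t.+1 t].
Proof.
move=> t0 tK; rewrite /boundary eqSS -/conn' -/T' eqn0Ngt t0 /= negb_or negbK => /andP[en].
rewrite negb_and !negbK => crossing; suff [] : conn' t t /\ conn' t.+1 t by [].
have usersP x : 0 < x -> x <= K -> x \in users K by rewrite mem_users => -> ->.
case/orP: crossing => /hasP[y]; rewrite mem_iota => /andP[y1 y2].
  case/hasP => z zT cz; rewrite add1n ltnS in y2.
  have yK := usersP y y1 (leq_trans y2 (ltnW tK)).
  have zt : t <= z by case: (conn_near (reduced_conn_conn cz)) => [->//|[->]].
  case: (reducedP yK zT) => [[zE c]|[zE c]|[zE [_ c1 c2 c3]]|[zE _]].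
  - by have yt : y = t by [apply/eqP; rewrite eqn_leq y2 -zE]; rewrite zE yt in c cz.
  - by move: y2; rewrite -zE leqNgt ltnS zt.
  - case: (eqVneq y t) => [<-//|yt].
    have {}yt : y.+1 = t by apply/eqP; rewrite eqn_leq ltn_neqAle yt y2 -zE.
    by rewrite zE yt in c3 cz.
  - by move: y2; rewrite -zE leqNgt ltnW // !ltnS.
case/hasP => x; rewrite mem_iota add1n ltnS => /andP[x1 xt] /hasP[z zT cz].
have zx : z <= x by case: (conn_near (reduced_conn_conn cz)) => [->//|<-].
rewrite subnKC ?ltnS ?(ltnW tK) // in y2.
have yK : y \in users K by apply: usersP => //; exact: leq_ltn_trans y1.
have xE : t <= z -> x = t /\ z = t.
  by move=> tz; split; apply/eqP; rewrite eqn_leq ?xt ?tz ?(leq_trans zx) ?(leq_trans tz).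
case: (reducedP yK zT) => [[zE c]|[zE c]|[zE _]|[zE [_ c1 c2 c3]]].
- by move: y1; rewrite -zE ltnNge (leq_trans zx).
- by have [xE' zE'] := xE ltac:(by rewrite -ltnS zE); rewrite -zE xE' zE' in c cz *.
- by move: y1; rewrite ltnNge ltnW // -zE (leq_trans zx).
- case: (eqVneq z.+1 t) => [zt|zt]; first by rewrite -zE zt in c1 c2 *.
  have [xE' zE'] := xE ltac:(by rewrite -ltnS ltn_neqAle eq_sym zt -ltnS zE).
  by rewrite zE' xE' in c3 cz.
Qed.

(** * Conflicts forced on every zero-forcing scheme *)

Variables (R : fieldType) (H : nat -> nat -> R).
Hypothesis H_conn : forall i j, (H i j != 0)%R = conn i j.

Lemma reduced_conn_neq0 i j : conn' i j -> (H i j != 0)%R.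
Proof. by rewrite H_conn => /reduced_conn_conn. Qed.

Lemma H_eq0 i j : j != i -> j.+1 != i -> H i j = 0%R.
Proof.
move=> ji ji1; apply/eqP; apply: contraTT isT; rewrite H_conn => /conn_near[] /eqP.
  by rewrite (negbTE ji).
by rewrite (negbTE ji1).
Qed.

(** Both terms can be written even when i-1 or i is outside [A], since [f] vanishes there. *)
Lemma row_sum (A : {fset nat}) (f : nat -> R) i :
  (forall j, j \notin A -> f j = 0%R) -> 0 < i ->
  (\sum_(j <- A) H i j * f j = H i i.-1 * f i.-1 + H i i * f i)%R.
Proof.
move=> f0 i0; have ne : i.-1 != i by rewrite -{2}(prednK i0) neqSn.
rewrite (bigID [in [:: i.-1; i]]) /= addrC big1 ?add0r => [|j]; last first.
  rewrite !inE negb_or => /andP[j1 j2]; rewrite H_eq0 ?mul0r //.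
  by apply: contra j1 => /eqP <-.
rewrite -big_filter (perm_big [seq j <- [:: i.-1; i] | j \in A]); last first.
  apply: uniq_perm => [||j]; last by rewrite !mem_filter andbC.
    by rewrite filter_uniq // fset_uniq.
  by rewrite filter_uniq //= inE ne.
rewrite big_filter big_mkcond !big_cons big_nil /= addr0.
by congr (_ + _)%R; case: ifPn => // /f0 ->; rewrite mulr0.
Qed.

Section Scheme.
Variables (S : {fset nat}) (v : nat -> nat -> R).
Hypothesis zf : zf_scheme K T H S v.

Lemma scheme_enabled i : i \in S -> enabled conn T i.
Proof.
case: zf => _ _ desired _ /desired; apply: contraNT => /hasPn none.
apply/eqP; rewrite big_seq big1 // => j /none cj.
by move: cj; rewrite -H_conn negbK => /eqP ->; rewrite mul0r.
Qed.

Lemma scheme_users i : i \in S -> i \in users K.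
Proof. by case: zf => /fsubsetP sub _ _ _; apply: sub. Qed.

(** An arbitrary scheme may also use useless assignments; cutting them off preserves its equations
    at the active receivers. *)
Definition useful_coef i j : R := if j \in T' i then v i j else 0%R.

(* If a useless transmitter of T i reaches receiver k, then no useful one does. *)
Lemma useful_coef_row i k : i \in S -> k \in S ->
  (\sum_(j <- T i) H k j * v i j)%R =
    (H k k.-1 * useful_coef i k.-1 + H k k * useful_coef i k)%R \/
  k != i /\ (H k k.-1 * useful_coef i k.-1 + H k k * useful_coef i k)%R = 0%R.
Proof.
move=> iS kS; have iK := scheme_users iS; have kK := scheme_users kS.
have k0 : 0 < k by move: kK; rewrite mem_users => /andP[].
rewrite -(@row_sum (T i)) //; last first.
  by move=> j jT; rewrite /useful_coef mem_reduced (negbTE jT).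
have [/hasP[j jT /andP[jT' ckj]]|/hasPn none] :=
    boolP (has (fun j => (j \notin T' i) && conn k j) (T i)); last first.
  left; rewrite big_seq [RHS]big_seq; apply: eq_bigr => j jT.
  have := none j jT; rewrite /useful_coef negb_and negbK -H_conn negbK.
  by case: ifP => //= _ /eqP ->; rewrite !mul0r.
right; split.
  apply: contra jT' => /eqP kE; apply: marked_useful => //.
  rewrite /marked /conn' /reduced_conn -kE ckj scheme_enabled // andbT.
  by case: (conn_near ckj) => [->|->]; rewrite eqxx ?orbT.
rewrite big1_seq // => x /andP[_ xT]; rewrite /useful_coef; case: ifP => xT'; last by rewrite mulr0.
suff /negPn/eqP -> : ~~ (H k x != 0%R) by rewrite mul0r.
rewrite H_conn; apply: contra jT' => ckx; apply: common_receiver_useful xT' _ => //.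
apply/hasP; exists k; first by move: kK; rewrite mem_users mem_iota add1n ltnS.
by rewrite /conn' /reduced_conn scheme_enabled // ckj ckx.
Qed.

Lemma scheme_desired i : i \in S ->
  (H i i.-1 * useful_coef i i.-1 + H i i * useful_coef i i != 0)%R.
Proof.
move=> iS; case: zf => _ _ /(_ i iS) + _.
by case: (useful_coef_row iS iS) => [->//|[]]; rewrite eqxx.
Qed.

Lemma scheme_interference i k : i \in S -> k \in S -> k != i ->
  (H k k.-1 * useful_coef i k.-1 + H k k * useful_coef i k = 0)%R.
Proof.
move=> iS kS ki; case: zf => _ _ _ /(_ i k iS kS ki).
by case: (useful_coef_row iS kS) => [->//|[]].
Qed.

Lemma useful_coef_support i j : i \in S ->
  match kind_at i with
  | KOwn => j != i
  | KPrev => j.+1 != i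
  | KBoth => (j != i) && (j.+1 != i)
  | KNext => (j != i) && (j != i.+1)
  | KPrev2 => (j.+1 != i) && (j.+2 != i)
  end -> useful_coef i j = 0%R.
Proof.
move=> iS; rewrite /useful_coef; case: ifP => // jT.
have := kind_support (scheme_users iS) (scheme_enabled iS) jT.
case: (kind_at i) => [->|->|[]->|[]->|[]->]; by rewrite eqxx ?andbF.
Qed.

(** The conflicting message has transmitter i as its only useful one, and both receivers i and i+1
    hear it: silencing it at the undesired receiver also kills the desired signal. *)
Lemma scheme_pair i : i \in S -> i.+1 \in S -> conn i i -> conn i.+1 i ->
  ~~ pair_conflict (kind_at i) (kind_at i.+1).
Proof.
rewrite -!H_conn => iS i1S hii hi1i; apply/negP => conf.
have zero x y : (x != 0 -> x * y = 0 -> y = 0 :> R)%R.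
  by move=> x0 /eqP; rewrite mulf_eq0 (negbTE x0) => /eqP.
have [own|prev] : kind_at i = KOwn \/ kind_at i.+1 = KPrev.
  by move: conf; case: (kind_at i) (kind_at i.+1) => [] []; auto.
- have supp j : j != i -> useful_coef i j = 0%R.
    by move=> ji; apply: useful_coef_support; rewrite // own.
  have := scheme_interference iS i1S; rewrite neqnS => /(_ isT).
  rewrite /= [useful_coef i i.+1]supp ?neqnS // mulr0 addr0 => /(zero _ _ hi1i) w0.
  have := scheme_desired iS; rewrite w0 [useful_coef i i.-1]supp ?mulr0 ?addr0 ?eqxx //.
  have i0 : 0 < i by have := scheme_users iS; rewrite mem_users => /andP[].
  by rewrite -{2}(prednK i0) neqSn.
- have supp j : j != i -> useful_coef i.+1 j = 0%R.
    by move=> ji; apply: useful_coef_support; rewrite // prev.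
  have i0 : 0 < i by have := scheme_users iS; rewrite mem_users => /andP[].
  have predi : i.-1 != i by rewrite -{2}(prednK i0) neqSn.
  have := scheme_interference i1S iS; rewrite neqSn => /(_ isT).
  rewrite [useful_coef _ i.-1]supp // mulr0 add0r => /(zero _ _ hii) w0.
  by have := scheme_desired i1S; rewrite /= w0 [useful_coef _ i.+1]supp ?mulr0 ?addr0 ?eqxx ?neqnS.
Qed.

(** The conflicting message is carried by transmitters i and i+1 only. The equations at the two
    undesired receivers form an invertible triangular or diagonal system, so both coefficients
    vanish. *)
Lemma scheme_triple i : i \in S -> i.+1 \in S -> i.+2 \in S ->
  conn i i -> conn i.+1 i -> conn i.+1 i.+1 -> conn i.+2 i.+1 ->
  ~~ triple_conflict (kind_at i) (kind_at i.+1) (kind_at i.+2).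
Proof.
rewrite -!H_conn => iS i1S i2S hii hi1i hi1i1 hi2i1; apply/negP => conf.
have zero x y : (x != 0 -> x * y = 0 -> y = 0 :> R)%R.
  by move=> x0 /eqP; rewrite mulf_eq0 (negbTE x0) => /eqP.
have i0 : 0 < i by have := scheme_users iS; rewrite mem_users => /andP[].
have predi : i.-1 != i by rewrite -{2}(prednK i0) neqSn.
have predi1 : i.-1 != i.+1 by rewrite -{2}(prednK i0) neqSSn.
have [next|[both|prev2]] :
    kind_at i = KNext \/ kind_at i.+1 = KBoth \/ kind_at i.+2 = KPrev2.
  by move: conf; case: (kind_at i) (kind_at i.+1) (kind_at i.+2) => [] [] []; auto.
- have supp j : j != i -> j != i.+1 -> useful_coef i j = 0%R.
    by move=> ji ji1; apply: useful_coef_support; rewrite // next ji.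
  have := scheme_interference iS i2S; rewrite neqnSS => /(_ isT).
  rewrite /= [useful_coef i i.+2]supp ?neqE // mulr0 addr0 => /(zero _ _ hi2i1) w1.
  have := scheme_interference iS i1S; rewrite neqnS => /(_ isT).
  rewrite /= w1 mulr0 addr0 => /(zero _ _ hi1i) w0.
  by have := scheme_desired iS; rewrite w0 [useful_coef i i.-1]supp ?mulr0 ?addr0 ?eqxx.
- have supp j : j != i -> j != i.+1 -> useful_coef i.+1 j = 0%R.
    by move=> ji ji1; apply: useful_coef_support; rewrite // both ji1.
  have := scheme_interference i1S i2S; rewrite neqnS => /(_ isT).
  rewrite /= [useful_coef _ i.+2]supp ?neqE // mulr0 addr0 => /(zero _ _ hi2i1) w1.
  have := scheme_interference i1S iS; rewrite neqSn => /(_ isT).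
  rewrite [useful_coef _ i.-1]supp // mulr0 add0r => /(zero _ _ hii) w0.
  by have := scheme_desired i1S; rewrite /= w0 w1 !mulr0 addr0 eqxx.
- have supp j : j != i -> j != i.+1 -> useful_coef i.+2 j = 0%R.
    by move=> ji ji1; apply: useful_coef_support; rewrite // prev2 !eqSS ji1.
  have := scheme_interference i2S iS; rewrite neqSSn => /(_ isT).
  rewrite [useful_coef _ i.-1]supp // mulr0 add0r => /(zero _ _ hii) w0.
  have := scheme_interference i2S i1S; rewrite neqSn => /(_ isT).
  rewrite /= w0 mulr0 add0r => /(zero _ _ hi1i1) w1.
  have := scheme_desired i2S.
  by rewrite /= w1 [useful_coef _ i.+2]supp ?neqE // !mulr0 addr0 eqxx.
Qed.
End Scheme.

(** * Links and transmit sets inside an atomic subnetwork *)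

Section Atomic.
Variables m k : nat.
Hypothesis mk_atomic : atomic K conn T m k.

Lemma atomic_start : 0 < m. Proof. by case: mk_atomic => /and5P[]. Qed.
Lemma atomic_size : 0 < k. Proof. by case: mk_atomic => /and5P[]. Qed.
Lemma atomic_le : m + k <= K.+1. Proof. by case: mk_atomic => /and5P[]. Qed.

Lemma atomic_users i : m <= i < m + k -> i \in users K.
Proof.
case/andP=> mi imk; rewrite mem_users (leq_trans atomic_start mi).
exact: leq_trans imk atomic_le.
Qed.

(** An inner boundary would cut off a smaller subnetwork starting at [m]. *)
Lemma atomic_inner i : m <= i -> i.+1 < m + k -> ~~ boundary K conn T i.+1.
Proof.
move=> mi imk; apply/negP => bd; case: mk_atomic => /and5P[m0 k0 mkK bm _] minimal.
have mi1 : m + (i.+1 - m) = i.+1 by rewrite subnKC // leqW.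
have [] := minimal m (i.+1 - m) _ (leqnn m) _; rewrite ?mi1 //.
- rewrite /subnetwork m0 bm mi1 bd orbT subn_gt0 ltnS mi /= andbT.
  exact: leq_trans (ltnW imk) mkK.
- exact: ltnW.
- by move=> _ ik; move: imk; rewrite -ik mi1 ltnn.
Qed.

Lemma atomic_links i : m <= i -> i.+1 < m + k ->
  [/\ enabled conn T i.+1, conn' i i & conn' i.+1 i].
Proof.
move=> mi imk; apply: inner_links; last exact: atomic_inner.
  exact: leq_trans atomic_start mi.
by rewrite -ltnS; apply: leq_trans imk atomic_le.
Qed.

Lemma atomic_enabled : 1 < k -> all (enabled conn T) (iota m k).
Proof.
move=> k1; apply/allP => i; rewrite mem_iota => /andP[mi imk].
case: (ltnP i.+1 (m + k)) => [lt|ge].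
  by have [_ /andP[]] := atomic_links mi lt.
case: i => [|i] in mi imk ge *; first by move: mi; rewrite leqNgt atomic_start.
have lt_mi : m.+2 <= i.+2 by rewrite -addn2; apply: leq_trans ge; rewrite leq_add2l.
by have [] := atomic_links (lt_mi : m <= i) imk.
Qed.

(** A useful transmitter heard outside would contradict the boundary at [m + k] or the one at
    [m]. *)
Lemma no_leak i j r : m <= i < m + k -> j \in T' i -> conn' r j -> m <= r < m + k.
Proof.
move=> imk jT crj; have iK := atomic_users imk; case/andP: (imk) => mi ik.
have [rK _] := conn_users (reduced_conn_conn crj).
have r0 : 0 < r by move: rK; rewrite mem_users => /andP[].
have rleK : r <= K by move: rK; rewrite mem_users => /andP[].
case: (leqP m r) => [mr|rm] /=.
  rewrite ltnNge; apply/negP => er.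
  have ejr : j <= r <= j.+1.
    by case: (conn_near (reduced_conn_conn crj)) => [->|<-]; rewrite leqnn leqnSn.
  (* The boundary only speaks of receiver m+k. If [r] lies beyond it, then j = i+1 = m+k, and
     [reducedP] connects this transmitter to receiver m+k too. *)
  have [z zT cz] : exists2 z, z \in T' i & conn' (m + k) z.
    exists j => //; case: (eqVneq r (m + k)) => [<-//|rmk].
    have rgt : m + k < r by rewrite ltn_neqAle eq_sym rmk.
    have ej : m + k <= j by rewrite -ltnS; apply: leq_trans rgt _; case/andP: ejr.
    have ij : i < j by exact: leq_trans ej.
    case: (reducedP iK jT) => [[jE _]|[jE _]|[jE [_ _ _ c]]|[jE _]].
    - by rewrite jE ltnn in ij.
    - by rewrite -jE ltnNge leqnSn in ij.
    - have -> : m + k = i.+1 by apply/eqP; rewrite eqn_leq ik andbT -jE.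
      by rewrite jE.
    - by rewrite -jE ltnNge leqW // leqnSn in ij.
  case: mk_atomic => /and5P[_ _ _ _ end_mk] _.
  have {end_mk} : boundary K conn T (m + k).
    case/orP: end_mk => // /eqP mkK; have {}mkK : m + k = K.+1 := mkK.
    by move: er; rewrite mkK leqNgt ltnS rleK.
  have [en _] := andP cz; rewrite /boundary -/conn' -/T' en /=.
  have -> /= : (m + k == 1) = false.
    by apply/gtn_eqF; rewrite -addn1 leq_add ?atomic_start ?atomic_size.
  case/andP=> /hasPn /(_ i) + _; rewrite mem_iota add1n.
  rewrite (prednK (leq_ltn_trans (leq0n i) ik)) ik (leq_trans atomic_start mi).
  by move=> /(_ isT) /hasP; apply; exists z.
exfalso; case: mk_atomic => /and5P[_ _ mkK bm _] _; move: bm.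
(* A boundary at [m] could also come from a message that is not enabled; here either [W_m] itself
   has a useful transmitter or [m] is the receiver of an inner link. *)
have en : enabled conn T m.
  case: (eqVneq m i) => [->|mi'].
    by case: (reducedP iK jT) => [[_ /andP[]]|[_ /andP[]]|[_ [_ /andP[]]]|[_ [_ /andP[]]]].
  have lt_mi : m < i by rewrite ltn_neqAle mi' mi.
  by have [_ /andP[]] := atomic_links (leqnn m) (leq_ltn_trans lt_mi ik).
rewrite /boundary -/conn' -/T' en /= gtn_eqF ?(leq_ltn_trans r0) //=.
case/andP=> _ /hasPn /(_ i); rewrite mem_iota mi subnKC ?ltnS.
  have := iK; rewrite mem_users => /andP[_ ->] /(_ isT) /hasP; apply; exists r.
    by rewrite mem_iota r0 add1n prednK // atomic_start.
  by apply/hasP; exists j.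
by apply: leq_trans mkK; rewrite leq_addr.
Qed.

Let o := m.-1.
Let t r := kind_at (o + r).
Let has_msg : rel nat := fun r s => o + s \in T' (o + r).

Lemma atomic_offset : o.+1 = m. Proof. by rewrite prednK ?atomic_start. Qed.

Lemma atomic_local r : 0 < r <= k -> m <= o + r < m + k.
Proof.
by case/andP=> r0 rk; rewrite -atomic_offset -addn1 leq_add2l r0 addn1 addSn ltnS leq_add2l.
Qed.

Hypothesis all_enabled : all (enabled conn T) (iota m k).

Lemma atomic_local_enabled r : 0 < r <= k ->
  o + r \in users K /\ enabled conn T (o + r).
Proof.
move=> /atomic_local rmk; split; first exact: atomic_users.
by apply: (allP all_enabled); rewrite mem_iota.
Qed.

(** Transmitter m-2 would be useful for the first user only through receiver m-1, and transmitter
    m+k for the last user only through receiver m+k; [no_leak] excludes both. *)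
Lemma atomic_kinds : kinds_of k has_msg t.
Proof.
split=> [i ik|i ik|i ik|i /andP[i0 ik]||].
- by have [iK en] := atomic_local_enabled ik; have [-> _ _ _] := kind_atP iK en.
- have [iK en] := @atomic_local_enabled i.+1 ik; have [_ -> _ _] := kind_atP iK en.
  by rewrite /has_msg !addnS.
- have [iK en] := @atomic_local_enabled i.+2 ik; have [_ _ -> _] := kind_atP iK en.
  by rewrite /has_msg !addnS.
- have [|iK en] := @atomic_local_enabled i; first by rewrite i0 ltnW.
  by have [_ _ _ ->] := kind_atP iK en; rewrite /has_msg !addnS.
- have [|] := @atomic_local_enabled 1; first by rewrite atomic_size.
  rewrite /t addn1 atomic_offset => mK en; have [_ _ -> _] := kind_atP mK en.
  apply/negP => mT; have := reduced_users mK mT; rewrite mem_users => /andP[m2 _].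
  have : m.-2.+2 = m by move: m2; case: (m) => [|[]].
  move: m.-2 mT => x xT xE.
  case: (reducedP mK xT) => [[/eqP]|[/eqP]|[/eqP]|[_ [_ _ _ c]]]; rewrite -?xE ?neqE //.
  have mm : m <= m < m + k by rewrite leqnn -addn1 leq_add2l atomic_size.
  by have := no_leak mm xT c; rewrite -{1}xE ltnn.
- have [|] := @atomic_local_enabled k; first by rewrite atomic_size leqnn.
  move=> kK en; have [_ _ _ ->] := kind_atP kK en.
  apply/negP => kT.
  case: (reducedP kK kT) => [[/eqP]|[/eqP]|[_ [_ _ _ c]]|[/eqP]]; rewrite ?neqE //.
  have [|_] := andP (no_leak _ kT c); first by rewrite atomic_local // atomic_size leqnn.
  by rewrite -atomic_offset addSn ltnn.
Qed.

Lemma atomic_reducedP r s : has_msg r s -> 0 < r <= k ->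
  [\/ s = r /\ conn' (o + r) (o + r), s.+1 = r /\ conn' (o + r) (o + s),
      s = r.+1 /\ [/\ has_msg r r, conn' (o + r) (o + r), conn' (o + r.+1) (o + r) &
                   conn' (o + r.+1) (o + r.+1)] |
      s.+2 = r /\ [/\ has_msg r s.+1, conn' (o + r) (o + s.+1),
                   conn' (o + s.+1) (o + s.+1) & conn' (o + s.+1) (o + s)]].
Proof.
move=> rs rk; have [rK _] := atomic_local_enabled rk.
have inj x y : o + x = o + y -> x = y by move/addnI.
case: (reducedP rK rs) => [[/inj ? c]|[E c]|[E c]|[E c]].
- by constructor 1.
- by constructor 2; split=> //; apply: inj; rewrite addnS.
- by constructor 3; rewrite /has_msg addnS; split=> //; apply: inj; rewrite addnS.
- by constructor 4; rewrite /has_msg addnS; split=> //; apply: inj; rewrite !addnS.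
Qed.

Lemma atomic_local_links i : 0 < i < k ->
  conn' (o + i) (o + i) /\ conn' (o + i.+1) (o + i).
Proof.
case/andP=> i0 ik; have := @atomic_local i; rewrite i0 (ltnW ik) => /(_ isT) /andP[mi _].
have := @atomic_local i.+1 ik => /andP[_ imk].
by rewrite addnS in imk *; have [] := atomic_links mi imk.
Qed.

Lemma atomic_linked : links_of k (fun r s => H (o + r) (o + s)) t.
Proof.
have kinds := atomic_kinds.
have inner := atomic_local_links.
split=> [i ik own|i ik prev|i ik prev2|i /inner[c _]|i /inner[_ c]|i ik next];
  apply: reduced_conn_neq0 => //.
- rewrite -(kind_own kinds) // in own.
  by case: (atomic_reducedP own ik) => [[_ //]|[/eqP]|[/eqP]|[/eqP]]; rewrite ?neqE.
- rewrite -(kind_prev kinds) // in prev.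
  by case: (atomic_reducedP prev) => // [[/eqP]|[_ //]|[/eqP]|[/eqP]]; rewrite ?neqE.
- rewrite -(kind_prev2 kinds) // in prev2.
  by case: (atomic_reducedP prev2) => // [[/eqP]|[/eqP]|[/eqP]|[_ []]]; rewrite ?neqE.
- rewrite -(kind_next kinds) // in next; have ik' : 0 < i <= k by case/andP: ik => -> /ltnW.
  by case: (atomic_reducedP next ik') => [[/eqP]|[/eqP]|[_ []]|[/eqP]]; rewrite ?neqE.
Qed.

Lemma scheme_conflict_free S v : zf_scheme K T H S v ->
  conflict_free k t (fun r => o + r \in S).
Proof.
move=> zf; split=> [i ik|i i0 ik].
  have [c1 c2] := atomic_local_links ik; move: c1 c2; rewrite /t /= addnS.
  move=> /reduced_conn_conn c1 /reduced_conn_conn c2 iS i1S.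
  exact: (scheme_pair zf iS i1S c1 c2).
have [|c1 c2] := @atomic_local_links i; first by rewrite i0 ltnW.
have [//|c3 c4] := @atomic_local_links i.+1.
move: c1 c2 c3 c4; rewrite /t /= !addnS.
move=> /reduced_conn_conn c1 /reduced_conn_conn c2 /reduced_conn_conn c3.
move=> /reduced_conn_conn c4 iS i1S i2S.
exact: (scheme_triple zf iS i1S i2S c1 c2 c3 c4).
Qed.

End Atomic.

(** * Optimality on one atomic subnetwork *)

(** Everything needed to glue subnetworks, in global labels and without reference to modes. *)
Record subnetwork_optimal (q : nat * nat) (a : pred nat) : Prop := SubnetworkOptimal {
  optimal_enabled : forall i, a i -> i \in iota q.1 q.2 /\ enabled conn T i;
  optimal_support : forall i j, subnetwork_coef K conn T H q i j != 0%R -> a i /\ j \in T' i;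
  optimal_desired : forall i, a i ->
    (H i i.-1 * subnetwork_coef K conn T H q i i.-1
     + H i i * subnetwork_coef K conn T H q i i != 0)%R;
  optimal_interference : forall i r, a i -> a r -> r != i ->
    (H r r.-1 * subnetwork_coef K conn T H q i r.-1
     + H r r * subnetwork_coef K conn T H q i r = 0)%R;
  optimal_count : forall S v, zf_scheme K T H S v ->
    count [in S] (iota q.1 q.2) <= count a (iota q.1 q.2) }.

Lemma atomic_optimal m k : atomic K conn T m k ->
  exists a, subnetwork_optimal (m, k) a.
Proof.
move=> at_mk; have m1 : m.-1.+1 = m := atomic_offset at_mk.
have [en|dis] := boolP (all (enabled conn T) (iota m k)); last first.
  (* A message that is not enabled makes the subnetwork a single user, which neither the algorithm
     nor any scheme serves. *)
  have k1 : k = 1.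
    apply/eqP; rewrite eqn_leq (atomic_size at_mk) andbT leqNgt.
    by apply: contra dis => /(atomic_enabled at_mk).
  have coef0 i j : subnetwork_coef K conn T H (m, k) i j = 0%R.
    by rewrite /subnetwork_coef /= (negbTE dis).
  exists pred0; split=> // [i j|S v zf]; first by rewrite coef0 eqxx.
  rewrite k1 /= in dis *; rewrite andbT in dis.
  by rewrite (contraNF (scheme_enabled zf (i := m)) dis).
have kinds := atomic_kinds at_mk en; have links := atomic_linked at_mk en.
have k0 := atomic_size at_mk.
have [md sch] := schedule_run kinds links k0.
set o := m.-1 in m1 kinds links sch *.
pose t r := kind_at (o + r).
have coefE r s : 0 < r <= k -> subnetwork_coef K conn T H (m, k) (o + r) (o + s) =
    beam (fun r s => H (o + r) (o + s)) (md r) r s.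
  move=> rk; rewrite /subnetwork_coef en /= -/o -{1}(addn0 o) ltn_add2l leq_addr.
  rewrite !addKn -(algorithm_coefE kinds links sch) //.
  by case/andP: rk => ->.
have coef_out i j : ~~ (m <= i < m + k) -> subnetwork_coef K conn T H (m, k) i j = 0%R.
  move=> out; rewrite /subnetwork_coef /= -/o; case: ifP => // /and3P[_ oi _].
  rewrite /algorithm_coef ifF //; apply: contraNF out => /and3P[/andP[i0 ik] _ _].
  by rewrite -m1 oi addSn ltnS -leq_subLR.
have local i : m <= i < m + k -> exists2 r, 0 < r <= k & i = o + r.
  rewrite -m1 addSn ltnS -leq_subLR => /andP[oi ik].
  by exists (i - o); rewrite ?subn_gt0 ?oi // subnKC // ltnW.
pose a i := (o < i) && active (md (i - o)).
have aE r : 0 < r -> a (o + r) = active (md r).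
  by move=> r0; rewrite /a addKn -{1}(addn0 o) ltn_add2l r0.
have a_local i : a i -> exists2 r, 0 < r <= k & i = o + r /\ active (md r).
  move=> /andP[oi ai]; exists (i - o); first exact: (schedule_active sch ai).
  by rewrite subnKC // ltnW.
have pred_local r : 0 < r -> (o + r).-1 = o + r.-1 by case: r => // r; rewrite addnS.
exists a; split=> [i|i j|i|i i'|S v zf].
- move=> /a_local[r rk [-> _]]; rewrite mem_iota atomic_local //; split=> //.
  by have [] := atomic_local_enabled at_mk en rk.
- case: (boolP (m <= i < m + k)) => [/local[r rk ->]|/coef_out ->]; last by rewrite eqxx.
  case: (leqP o j) => [oj|jo]; last first.
    by rewrite /subnetwork_coef /= -/o (leqNgt o j) jo !andbF eqxx.
  rewrite -(subnKC oj) coefE // => nz; have [_ + _] := beam_neq0 kinds links sch rk nz.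
  split=> //; case/andP: rk => r0 _; rewrite aE //.
  by move: nz; case: (md r) => //=; rewrite eqxx.
- move=> /a_local[r rk [-> ar]]; case/andP: (rk) => r0 _; rewrite pred_local // !coefE //.
  exact: (active_desired links sch ar).
- move=> /a_local[r rk [-> ar]] /a_local[r' rk' [-> ar']]; rewrite eqn_add2l => r'r.
  case/andP: (rk') => r'0 _; rewrite pred_local // !coefE //.
  exact: (active_interference kinds links sch ar ar' r'r).
- rewrite /= -m1 -addn1 iotaDl !count_map.
  have free := scheme_conflict_free at_mk zf.
  have a0 : (active \o md) 0 = false.
    by apply/negP => /(schedule_active sch).
  have := greedy_stays_ahead a0 (schedule_blocked sch) free (leqnn k).
  rewrite (@eq_in_count _ (preim (addn o) a) (active \o md)) // => r.
  by rewrite mem_iota => /andP[r0 _] /=; rewrite aE.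
Qed.

(** * Partition of the network and gluing *)

(** Blocks are cut off from the left, each as short as possible, which makes them atomic. The start
    must be a boundary only if users remain, since K+1 need not be one. *)
Lemma exists_partition : exists p, atomic_partition K conn T p.
Proof.
suff cut n i : 0 < i -> i + n = K.+1 -> (0 < n -> boundary K conn T i) -> exists p,
    (forall q, q \in p -> atomic K conn T q.1 q.2) /\
    flatten [seq iota q.1 q.2 | q <- p] = iota i n.
  by apply: (cut K 1) => //; rewrite /boundary eqxx.
elim/ltn_ind: n i => -[|n] IH i i0 iK bi; first by exists [::].
have ex : exists k, (0 < k) && ((i + k == K.+1) || boundary K conn T (i + k)).
  by exists n.+1; rewrite iK eqxx.
case: (ex_minnP ex) => k /andP[k0 kend] kmin.
have kn : k <= n.+1 by apply: kmin; rewrite iK eqxx.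
have sub_ik : subnetwork K conn T i k.
  by rewrite /subnetwork i0 k0 kend bi // -iK leq_add2l kn.
have [||||p [at_p flat]] := IH (n.+1 - k) _ (i + k).
- by rewrite ltnS leq_subLR -{1}(add1n n) leq_add2r.
- by rewrite addn_gt0 i0.
- by rewrite -addnA subnKC.
- rewrite subn_gt0 => ltk; case/orP: kend => // /eqP ikK; have {}ikK : i + k = K.+1 := ikK.
  by move: ltk; rewrite -(ltn_add2l i) iK ikK ltnn.
exists ((i, k) :: p); split=> [q|]; last by rewrite /= flat -iotaD subnKC.
rewrite inE => /predU1P[->|]; last exact: at_p.
split=> //= i' k' /and5P[i'0 k'0 i'k'K bi' end'] ii' ik'.
have i'i : i' = i.
  apply/eqP; rewrite eqn_leq ii' andbT leqNgt; apply/negP => lt_ii'.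
  have := kmin (i' - i); rewrite subn_gt0 lt_ii' subnKC // bi' orbT => /(_ isT).
  rewrite leqNgt => /negP; apply; rewrite ltn_subLR //; apply: leq_trans ik'.
  by rewrite -addn1 leq_add2l.
split=> //; apply/eqP; rewrite i'i in ik' end' *; rewrite eqn_leq -(leq_add2l i) ik' kmin //.
by rewrite k'0.
Qed.

Lemma sum_block (V : zmodType) (p : seq (nat * nat)) (F : nat * nat -> V) i q :
  uniq (flatten [seq iota r.1 r.2 | r <- p]) -> q \in p -> i \in iota q.1 q.2 ->
  (forall r, r \in p -> i \notin iota r.1 r.2 -> F r = 0%R) ->
  (\sum_(r <- p) F r = F q)%R.
Proof.
elim: p => [//|r p IH] /=; rewrite cat_uniq => /and3P[_ disj u] qp iq F0.
have in_flat x : x \in p -> i \in iota x.1 x.2 ->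
    i \in flatten [seq iota r.1 r.2 | r <- p].
  by move=> xp ix; apply/flattenP; exists (iota x.1 x.2) => //; apply: map_f.
rewrite big_cons; case: (boolP (i \in iota r.1 r.2)) => ir.
  have out x : x \in p -> i \notin iota x.1 x.2.
    by move=> xp; apply: contra disj => /(in_flat x xp) ?; apply/hasP; exists i.
  rewrite big1_seq ?addr0 => [|x /andP[_ xp]].
    by move: qp; rewrite inE => /predU1P[->//|/out]; rewrite iq.
  by apply: F0; rewrite ?inE ?xp ?orbT ?out.
rewrite F0 ?mem_head // add0r; apply: IH => // [|x xp].
  by move: qp; rewrite inE => /predU1P[qr|//]; rewrite -qr iq in ir.
by apply: F0; rewrite inE xp orbT.
Qed.

Lemma card_users (S : {fset nat}) :
  (S `<=` users K)%fset -> #|` S| = count [in S] (iota 1 K).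
Proof.
move/fsubsetP => sub; rewrite -size_filter; apply: perm_size; apply: uniq_perm.
- exact: fset_uniq.
- by rewrite filter_uniq // iota_uniq.
- move=> i; rewrite mem_filter; case: (boolP (i \in S)) => //= /sub.
  by rewrite mem_users mem_iota add1n ltnS.
Qed.

Section Partition.
Variable p : seq (nat * nat).
Hypothesis p_partition : atomic_partition K conn T p.
Let v := network_coef K conn T H p.
Let S := network_active K conn T H p.

Lemma partition_block i : i \in users K ->
  exists q, exists a, [/\ q \in p, i \in iota q.1 q.2 & subnetwork_optimal q a].
Proof.
rewrite mem_users => iK; have [at_p flat] := p_partition.
have : i \in flatten [seq iota q.1 q.2 | q <- p] by rewrite flat mem_iota add1n ltnS.
case/flattenP => _ /mapP[q qp ->] iq; have [a opt] := atomic_optimal (at_p q qp).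
by exists q, a; split=> //; case: q opt {qp iq}.
Qed.

Lemma network_coefE q i j : q \in p -> i \in iota q.1 q.2 ->
  v i j = subnetwork_coef K conn T H q i j.
Proof.
move=> qp iq; have [at_p flat] := p_partition.
apply: (sum_block _ qp iq); first by rewrite flat iota_uniq.
move=> r rp ir; have [a opt] := atomic_optimal (at_p r rp).
apply/eqP; apply: contraNT ir; rewrite (surjective_pairing r) => nz.
by have [ai _] := optimal_support opt nz; have [] := optimal_enabled opt ai.
Qed.

Lemma mem_network_active q a i : q \in p -> subnetwork_optimal q a ->
  i \in iota q.1 q.2 -> (i \in S) = a i.
Proof.
move=> qp opt iq; have [at_p flat] := p_partition.
have iK : i \in users K.
  have : i \in iota 1 K by rewrite -flat; apply/flattenP; exists (iota q.1 q.2) => //; apply: map_f.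
  by rewrite mem_users mem_iota add1n ltnS.
have := iK; rewrite /S /network_active /users !inE /= => -> /=.
apply/hasP/idP => [[j _]|ai].
  by rewrite -/v (network_coefE _ qp iq) => /(optimal_support opt)[].
(* The desired signal of an active user is nonzero, so one of its two coefficients is. *)
have [j nz] : exists j, subnetwork_coef K conn T H q i j != 0%R.
  have := optimal_desired opt ai.
  have [->|nz _] := eqVneq (subnetwork_coef K conn T H q i i) 0%R; last by exists i.
  have [->|nz _] := eqVneq (subnetwork_coef K conn T H q i i.-1) 0%R; last by exists i.-1.
  by rewrite !mulr0 addr0 eqxx.
have [_ jT] := optimal_support opt nz.
exists j; last by rewrite -/v (network_coefE _ qp iq).
by have := reduced_users iK jT; rewrite mem_users mem_iota add1n ltnS.
Qed.

Lemma network_active_users : (S `<=` users K)%fset.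
Proof. by apply/fsubsetP => i; rewrite /S /network_active /users !inE => /andP[]. Qed.

Lemma network_coef_support i j : v i j != 0%R -> i \in S /\ j \in T' i.
Proof.
move=> nz; have [at_p flat] := p_partition.
have [q qp nzq] : exists2 q, q \in p & subnetwork_coef K conn T H q i j != 0%R.
  apply/hasP; apply: contraNT nz => /hasPn none.
  by rewrite /v /network_coef big_seq big1 // => q /none /negPn/eqP.
have [a opt] := atomic_optimal (at_p q qp); rewrite -surjective_pairing in opt.
have [ai jT] := optimal_support opt nzq; have [iq _] := optimal_enabled opt ai.
by rewrite (mem_network_active qp opt).
Qed.

Lemma network_scheme : zf_scheme K T H S v.
Proof.
have row i k : i \in S -> k \in S -> (\sum_(j <- T i) H k j * v i j)%R =
    (H k k.-1 * v i k.-1 + H k k * v i k)%R.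
  move=> iS /(fsubsetP network_active_users); rewrite mem_users => /andP[k0 _].
  apply: row_sum => // j; apply: contraNeq => /network_coef_support[_].
  by rewrite mem_reduced => /andP[].
split=> [|i j|i iS|i k iS kS ki].
- exact: network_active_users.
- apply: contraNeq => /network_coef_support[-> /=].
  by rewrite mem_reduced => /andP[].
- rewrite row //; have [q [a [qp iq opt]]] := partition_block (fsubsetP network_active_users i iS).
  rewrite !(network_coefE _ qp iq); apply: (optimal_desired opt).
  by rewrite -(mem_network_active qp opt iq).
- rewrite row //; have [q [a [qp iq opt]]] := partition_block (fsubsetP network_active_users i iS).
  have [at_p _] := p_partition.
  have ai : a i by rewrite -(mem_network_active qp opt iq).
  rewrite !(network_coefE _ qp iq); case: (boolP (k \in iota q.1 q.2)) => kq.
    by apply: (optimal_interference opt) => //; rewrite -(mem_network_active qp opt kq).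
  have [r [c [rp kr optr]]] := partition_block (fsubsetP network_active_users k kS).
  have ck : c k by rewrite -(mem_network_active rp optr kr).
  have [_ enk] := optimal_enabled optr ck.
  (* Receiver [k] belongs to another block. It is enabled, being active, so its links survive the
     reduction and [no_leak] applies to them. *)
  have silent j : (H k j * subnetwork_coef K conn T H q i j = 0)%R.
    apply/eqP; apply: contraNT kq; rewrite mulf_eq0 negb_or => /andP[hkj nz].
    have [_ jT] := optimal_support opt nz; rewrite H_conn in hkj.
    rewrite mem_iota; apply: (no_leak (at_p q qp) _ jT); first by rewrite -mem_iota.
    by rewrite /conn' /reduced_conn enk hkj.
  by rewrite !silent addr0.
Qed.

(** The blocks tile the users, so cardinalities are sums of counts over blocks, and the local bounds
    add up. *)
Lemma network_optimal : zf_optimal K T H S v.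
Proof.
split=> [|S' v' zf]; first exact: network_scheme.
have [at_p flat] := p_partition.
have sub : (S' `<=` users K)%fset by case: zf.
rewrite !card_users // ?network_active_users // -flat !count_flatten !sumnE !big_map.
rewrite big_seq [leqRHS]big_seq; apply: leq_sum => q qp.
have [a opt] := atomic_optimal (at_p q qp); rewrite -surjective_pairing in opt.
apply: leq_trans (optimal_count opt zf) _; rewrite leq_eqVlt; apply/orP; left; apply/eqP.
by apply: eq_in_count => i iq; rewrite /= (mem_network_active qp opt).
Qed.
End Partition.
End Topology.

(** * Random coefficients *)

Lemma link_users K erased i j : link K erased i j -> i \in users K /\ j \in users K.
Proof. by case/and4P. Qed.

Lemma link_near K erased i j : link K erased i j -> j = i \/ j.+1 = i.
Proof. by case/and4P=> _ _ /orP[] /eqP ->; auto. Qed.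

(** A continuous distribution gives the value 0 probability zero, and countably many null events
    have a null union. *)
Lemma channel_neq0 (d : measure_display) (Om : measurableType d) (R : realType)
    (P : probability Om R) (K : nat) (erased : rel nat) (g : nat -> nat -> {RV P >-> R}) :
  generic_coefficients K erased g ->
  {ae P, forall w i j, (channel K erased g w i j != 0%R) = link K erased i j}.
Proof.
case=> _ cont; apply: ae_foralln => i; apply: ae_foralln => j.
case: (boolP (link K erased i j)) => ij; last first.
  by apply: aeW => w; rewrite /channel (negbTE ij) eqxx.
exists (g i j @^-1` [set 0%R])%classic; split.
- by rewrite -[X in measurable X]setTI; exact: measurable_funP.
- exact: cont.
- by move=> w /=; rewrite /channel ij; case: eqVneq.
Qed.

Theorem theorem6 (d : measure_display) (Om : measurableType d) (R : realType)
    (P : probability Om R) (K : nat) (T : nat -> {fset nat})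
    (hT : forall i, i \in users K -> (T i `<=` users K)%fset)
    (hM : forall i, i \in users K -> (#|` T i| <= 2)%N)
    (erased : rel nat) (g : nat -> nat -> {RV P >-> R})
    (hg : generic_coefficients K erased g) :
  (exists p, atomic_partition K (link K erased) T p) /\
  (forall p, atomic_partition K (link K erased) T p ->
    {ae P, forall w,
      zf_optimal K T (channel K erased g w)
        (network_active K (link K erased) T (channel K erased g w) p)
        (network_coef K (link K erased) T (channel K erased g w) p)}).
Proof.
split=> [|p partition]; first exact: exists_partition.
(* The partition depends on the links only and is fixed before the coefficients are drawn; on this
   event the rest is deterministic. *)
apply: filterS (channel_neq0 hg) => w linkE.
by apply: network_optimal partition; rewrite //; [exact: link_users | exact: link_near].
Qed.
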